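(* Let $\mathcal{D}=(G,\chi,z,\lambda,q)$, $n$, $p=\chi(z)$ and $H_{\mathcal{D}}$ be as in the context, with $(p,q)\neq(1,-1)$, and let $V$ be a $k$-vector space. Each data consisting of - a $G\times\mathrm{Aut}_{\chi,z}(G)$-gradation $V=\bigoplus_{(g,\zeta)\in G\times\mathrm{Aut}_{\chi,z}(G)}V_{g,\zeta}$ of $V$, - an automorphism $\alpha\colon V\to V$ of $V$ such that $\alpha^n=\mathrm{id}$ if $\lambda(z^n-1_G)\ne0$, and $\alpha(V_{g,\zeta})=V_{g,\zeta}$ for all $(g,\zeta)\in G\times\mathrm{Aut}_{\chi,z}(G)$, - a map $U\colon V\to V$ such that $U\circ\alpha=q\,\alpha\circ U$, $U^n=0$ and $U(V_{g,\zeta})\subseteq V_{gz^{-1},\zeta}$ for all $(g,\zeta)\in G\times\mathrm{Aut}_{\chi,z}(G)$, determines univocally a right $H_{\mathcal{D}}$-comodule $(V,s)$, in which - $s\colon H_{\mathcal{D}}\otimes V\to V\otimes H_{\mathcal{D}}$ is the left transposition given by $s(gx^i\otimes v)=\alpha^i(v)\otimes\zeta(g)x^i$ for $v\in V_{\zeta}:=\bigoplus_{g\in G}V_{g,\zeta}$, - the coaction $\nu\colon V\to V\otimes H_{\mathcal{D}}$ of $(V,s)$ is defined by $$\nu(v):=\sum_{j=0}^{n-1}\frac{1}{(j)!_{qp}}U^j(v)\otimes z^{-j}gx^j\qquad\text{for all } v\in V_g:=\bigoplus_{\zeta\in\mathrm{Aut}_{\chi,z}(G)}V_{g,\zeta},\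 g\in G.$$ Furthermore, all the right $H_{\mathcal{D}}$-comodules with underlying $k$-vector space $V$ have this form.
   Context: $k$ is a field, all maps are $k$-linear, $\otimes=\otimes_k$, and the name of a space also denotes its identity map. For $t\in k$, $(j)_t=\sum_{i=0}^{j-1}t^i$ and $(j)!_t=(1)_t(2)_t\cdots(j)_t$. Data: $G$ is a finite group, $\chi\colon G\to k^\times$ a character, $z\in G$ central, $q\in k^\times$, $\lambda\in k$, $p:=\chi(z)$; $qp$ is a root of $1$ of order $n>1$; and $\chi^n=1$ if $\lambda(z^n-1_G)\ne0$. $H_{\mathcal D}$ is the braided Hopf algebra generated as an algebra by the group $G$ and an element $x$ with relations $x^n=\lambda(z^n-1_G)$, $xg=\chi(g)gx$ ($g\in G$); it has basis $\{gx^i:g\in G,0\le i<n\}$, comultiplication and counit determined by $\Delta(g)=g\otimes g$, $\Delta(x)=1\otimes x+x\otimes z$, $\epsilon(g)=1$, $\epsilon(x)=0$, and braid $c=c_q$, $c_q(gx^i\otimes hx^j)=q^{ij}hx^j\otimes gx^i$. (As in any braided bialgebra, $\Delta\mu=(\mu\otimes\mu)(H\otimes c\otimes H)(\Delta\otimes\Delta)$.) $\mathrm{Aut}_{\chi,z}(G)$ is the group of automorphisms $\phi$ of $G$ with $\phi(z)=z$ and $\chi\circ\phi=\chi$. For a braided bialgebra $H$ with braid $c$, a left $H$-space is a pair $(V,s)$ with $V$ a vector space and $s\colon H\otimes V\to V\otimes H$ a bijective map (left transposition) such that: $s(1_H\otimes v)=v\otimes1_H$; $s\circ(\mu\otimes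 V)=(V\otimes\mu)\circ(s\otimes H)\circ(H\otimes s)$; $(V\otimes\epsilon)\circ s=\epsilon\otimes V$; $(V\otimes\Delta)\circ s=(s\otimes H)\circ(H\otimes s)\circ(\Delta\otimes V)$; and $(s\otimes H)\circ(H\otimes s)\circ(c\otimes V)=(V\otimes c)\circ(s\otimes H)\circ(H\otimes s)$. A right $H$-comodule $(V,s)$ is a left $H$-space $(V,s)$ with an ordinary (coassociative, counital) right $H$-comodule structure $\nu\colon V\to V\otimes H$ on $V$ such that $(\nu\otimes H)\circ s=(V\otimes c)\circ(s\otimes H)\circ(H\otimes\nu)$. *)

(* Defs.v *)
From HB Require Import structures.
From mathcomp Require Import all_boot all_order all_fingroup all_algebra center.
From mathcomp Require Import generic_quotient boolp.

Set Implicit Arguments.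
Unset Strict Implicit.
Unset Printing Implicit Defensive.

Import GRing.Theory.
Local Open Scope ring_scope.
Local Open Scope quotient_scope.

Reserved Notation "U ⊗ V" (at level 40, left associativity).
Reserved Notation "u ⊗ₜ v" (at level 40, left associativity).

(* The tensor product of two vector spaces: formal sums of pairs, two of them
   being identified when every bilinear map takes the same value on both. *)
Section Tensor.
Variables (k : fieldType) (U V : lmodType k).

Definition tval (W : lmodType k) (b : U -> V -> W) (s : seq (U * V)) : W :=
  \sum_(p <- s) b p.1 p.2.

Definition tequiv (s t : seq (U * V)) : bool :=
  `[< forall (W : lmodType k) (b : {bilinear U -> V -> W}),
        tval b s = tval b t >].

Lemma tequiv_refl : reflexive tequiv.
Proof. by move=> s; apply/asboolP. Qed.

Lemma tequiv_sym : symmetric tequiv.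
Proof.
by move=> s t; apply/idP/idP => /asboolP st; apply/asboolP => W b; rewrite st.
Qed.

Lemma tequiv_trans : transitive tequiv.
Proof.
move=> t s u /asboolP st /asboolP tu; apply/asboolP => W b.
by rewrite st tu.
Qed.

Canonical tequiv_equiv := EquivRel tequiv tequiv_refl tequiv_sym tequiv_trans.

Definition tensor_sort := {eq_quot tequiv}.

HB.instance Definition _ := Choice.on tensor_sort.
HB.instance Definition _ := EqQuotient.on tensor_sort.

Definition tadd (a b : tensor_sort) : tensor_sort := \pi_tensor_sort (repr a ++ repr b).
Definition tscale (c : k) (a : tensor_sort) : tensor_sort :=
  \pi_tensor_sort [seq (c *: p.1, p.2) | p <- repr a].
Definition topp (a : tensor_sort) : tensor_sort := tscale (-1) a.

Definition tlift (W : lmodType k) (b : U -> V -> W) (t : tensor_sort) : W :=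
  tval b (repr t).

Lemma tlift_pi (W : lmodType k) (b : {bilinear U -> V -> W}) s :
  tlift b (\pi_tensor_sort s) = tval b s.
Proof.
have /eqmodP/asboolP H : repr (\pi_tensor_sort s) = s %[mod tensor_sort] by rewrite reprK.
exact: H.
Qed.

Lemma tensorP (a b : tensor_sort) :
  (forall (W : lmodType k) (f : {bilinear U -> V -> W}), tlift f a = tlift f b)
  <-> a = b.
Proof.
split=> [H|->//]; rewrite -[a]reprK -[b]reprK; apply/eqmodP/asboolP => W f.
exact: H.
Qed.

Lemma tval_cat (W : lmodType k) (b : U -> V -> W) s t :
  tval b (s ++ t) = tval b s + tval b t.
Proof. exact: big_cat. Qed.

Lemma tval_scale (W : lmodType k) (b : {bilinear U -> V -> W}) c s :
  tval b [seq (c *: p.1, p.2) | p <- s] = c *: tval b s.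
Proof.
rewrite /tval big_map scaler_sumr; apply: eq_bigr => p _ /=.
by rewrite linearZl_LR.
Qed.

Lemma tlift_add (W : lmodType k) (b : {bilinear U -> V -> W}) x y :
  tlift b (tadd x y) = tlift b x + tlift b y.
Proof. by rewrite tlift_pi tval_cat. Qed.

Lemma tlift_scale (W : lmodType k) (b : {bilinear U -> V -> W}) c x :
  tlift b (tscale c x) = c *: tlift b x.
Proof. by rewrite tlift_pi tval_scale. Qed.

Lemma tlift_zero (W : lmodType k) (b : {bilinear U -> V -> W}) :
  tlift b (\pi_tensor_sort [::]) = 0.
Proof. by rewrite tlift_pi /tval big_nil. Qed.

Fact taddA : associative tadd.
Proof. by move=> x y z; apply/tensorP => W b; rewrite !tlift_add addrA. Qed.
Fact taddC : commutative tadd.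
Proof. by move=> x y; apply/tensorP => W b; rewrite !tlift_add addrC. Qed.
Fact tadd0 : left_id (\pi_tensor_sort [::]) tadd.
Proof. by move=> x; apply/tensorP => W b; rewrite tlift_add tlift_zero add0r. Qed.
Fact taddN : left_inverse (\pi_tensor_sort [::]) topp tadd.
Proof.
move=> x; apply/tensorP => W b.
by rewrite tlift_add tlift_scale tlift_zero scaleN1r addNr.
Qed.

HB.instance Definition _ := GRing.isZmodule.Build tensor_sort taddA taddC tadd0 taddN.

Fact tscaleA a b x : tscale a (tscale b x) = tscale (a * b) x.
Proof. by apply/tensorP => W f; rewrite !tlift_scale scalerA. Qed.
Fact tscale1 : left_id 1 tscale.
Proof. by move=> x; apply/tensorP => W f; rewrite tlift_scale scale1r. Qed.
Fact tscaleDr : right_distributive tscale +%R.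
Proof.
move=> a x y; apply/tensorP => W f.
by rewrite tlift_scale /GRing.add/= !tlift_add !tlift_scale scalerDr.
Qed.
Fact tscaleDl x : {morph tscale^~ x : a b / a + b}.
Proof.
move=> a b; apply/tensorP => W f.
by rewrite [RHS]tlift_add !tlift_scale scalerDl.
Qed.

HB.instance Definition _ :=
  GRing.Zmodule_isLmodule.Build k tensor_sort tscaleA tscale1 tscaleDr tscaleDl.

Definition tensor : lmodType k := tensor_sort.

Definition tens (u : U) (v : V) : tensor := \pi_tensor_sort [:: (u, v)].

Fact tlift_is_linear (W : lmodType k) (b : {bilinear U -> V -> W}) :
  linear (tlift b).
Proof. by move=> a x y; rewrite [LHS]tlift_add tlift_scale. Qed.

HB.instance Definition _ (W : lmodType k) (b : {bilinear U -> V -> W}) :=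
  GRing.isLinear.Build k tensor W *:%R (tlift b : tensor -> W) (tlift_is_linear b).

Lemma tlift_tens (W : lmodType k) (b : {bilinear U -> V -> W}) u v :
  tlift b (tens u v) = b u v.
Proof. by rewrite tlift_pi /tval big_seq1. Qed.

Fact tens_is_bilinear : bilinear_for *:%R *:%R tens.
Proof.
split=> w a x y; apply/tensorP => W f; rewrite linearP /= !tlift_tens.
- exact: linearPl.
- exact: linearPr.
Qed.

HB.instance Definition _ := bilinear_isBilinear.Build k U V tensor *:%R *:%R
  tens tens_is_bilinear.

Definition tensl (u : U) (v : V) : tensor := tens u v.
Definition tensr (v : V) (u : U) : tensor := tens u v.

HB.instance Definition _ (u : U) := GRing.isLinear.Build k V tensor *:%R
  (tensl u) (linearPr _ u).
HB.instance Definition _ (v : V) := GRing.isLinear.Build k U tensor *:%R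
  (tensr v) (fun a x y => linearPl _ v a x y).

Lemma tens_sum (t : tensor) : t = \sum_(p <- repr t) tens p.1 p.2.
Proof.
apply/tensorP => W b; rewrite linear_sum /=.
by apply: eq_bigr => p _; rewrite tlift_tens.
Qed.

Lemma tens_ind (P : tensor -> Prop) :
  P 0 -> (forall u v, P (tens u v)) ->
  (forall s t, P s -> P t -> P (s + t)) -> forall t, P t.
Proof.
move=> P0 Pt PD t; rewrite [t]tens_sum.
by elim/big_rec: _ => // p s _ Ps; apply: PD.
Qed.

Lemma tens_ext (W : lmodType k) (f g : {linear tensor -> W}) :
  (forall u v, f (tens u v) = g (tens u v)) -> f =1 g.
Proof.
move=> fg t; rewrite [t]tens_sum !linear_sum; apply: eq_bigr => p _.
exact: fg.
Qed.

End Tensor.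

Notation "U ⊗ V" := (tensor U V).
Notation "u ⊗ₜ v" := (tens u v) : ring_scope.

(* [tmap f g] is the map f ⊗ g. *)
Section TensorMap.
Variables (k : fieldType) (U U' V V' : lmodType k).
Variables (f : {linear U -> U'}) (g : {linear V -> V'}).

Definition tmap_bil (u : U) (v : V) : U' ⊗ V' := f u ⊗ₜ g v.

Fact tmap_bil_is_bilinear : bilinear_for *:%R *:%R tmap_bil.
Proof.
split=> w a x y; rewrite /tmap_bil linearP /=.
- exact: linearPl.
- exact: linearPr.
Qed.

HB.instance Definition _ := bilinear_isBilinear.Build k U V (U' ⊗ V')
  *:%R *:%R tmap_bil tmap_bil_is_bilinear.

Definition tmap : U ⊗ V -> U' ⊗ V' := tlift tmap_bil.
HB.instance Definition _ := GRing.Linear.copy tmap (tlift tmap_bil).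

Lemma tmapE u v : tmap (u ⊗ₜ v) = f u ⊗ₜ g v.
Proof. exact: tlift_tens. Qed.

End TensorMap.

Section Associator.
Variables (k : fieldType) (U V W : lmodType k).

Definition tassoc_bil (t : U ⊗ V) (w : W) : U ⊗ (V ⊗ W) :=
  tmap idfun (tensr w) t.

Fact tassoc_bil_is_bilinear : bilinear_for *:%R *:%R tassoc_bil.
Proof.
split=> [w|t] a x y; first exact: linearP.
rewrite /tassoc_bil; elim/tens_ind: t => [|u v|t1 t2 IH1 IH2].
- by rewrite !linear0 /= scaler0 addr0.
- by rewrite !tmapE /= /tensr !linearPr.
- by rewrite !linearD /= IH1 IH2 scalerDr addrACA.
Qed.

HB.instance Definition _ := bilinear_isBilinear.Build k (U ⊗ V) W
  (U ⊗ (V ⊗ W)) *:%R *:%R tassoc_bil tassoc_bil_is_bilinear.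

Definition tassoc : (U ⊗ V) ⊗ W -> U ⊗ (V ⊗ W) := tlift tassoc_bil.
HB.instance Definition _ := GRing.Linear.copy tassoc (tlift tassoc_bil).

Lemma tassocE u v w : tassoc (u ⊗ₜ v ⊗ₜ w) = u ⊗ₜ (v ⊗ₜ w).
Proof. by rewrite /tassoc tlift_tens /= /tassoc_bil tmapE. Qed.

Definition tassocV_bil (u : U) (t : V ⊗ W) : (U ⊗ V) ⊗ W :=
  tmap (tensl u) idfun t.

Fact tassocV_bil_is_bilinear : bilinear_for *:%R *:%R tassocV_bil.
Proof.
split=> [t|u] a x y; last exact: linearP.
rewrite /tassocV_bil; elim/tens_ind: t => [|v w|t1 t2 IH1 IH2].
- by rewrite !linear0 /= scaler0 addr0.
- by rewrite !tmapE /= /tensl !linearPl.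
- by rewrite !linearD /= IH1 IH2 scalerDr addrACA.
Qed.

HB.instance Definition _ := bilinear_isBilinear.Build k U (V ⊗ W)
  ((U ⊗ V) ⊗ W) *:%R *:%R tassocV_bil tassocV_bil_is_bilinear.

Definition tassocV : U ⊗ (V ⊗ W) -> (U ⊗ V) ⊗ W := tlift tassocV_bil.
HB.instance Definition _ := GRing.Linear.copy tassocV (tlift tassocV_bil).

Lemma tassocVE u v w : tassocV (u ⊗ₜ (v ⊗ₜ w)) = u ⊗ₜ v ⊗ₜ w.
Proof. by rewrite /tassocV tlift_tens /= /tassocV_bil tmapE. Qed.

End Associator.

(* [teval_l f] and [teval_r f] are f ⊗ V and V ⊗ f for a linear form f, followed
   by the identifications k ⊗ V = V = V ⊗ k. *)
Section Forms.
Variables (k : fieldType) (A V : lmodType k) (f : {linear A -> k^o}).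

Definition teval_l_bil (a : A) (v : V) : V := (f a : k) *: v.
Definition teval_r_bil (v : V) (a : A) : V := (f a : k) *: v.

Fact teval_l_bil_is_bilinear : bilinear_for *:%R *:%R teval_l_bil.
Proof.
split=> w a x y; rewrite /teval_l_bil /=.
- by rewrite linearP /= scalerDl scalerA.
- by rewrite scalerDr !scalerA mulrC.
Qed.

Fact teval_r_bil_is_bilinear : bilinear_for *:%R *:%R teval_r_bil.
Proof.
split=> w a x y; rewrite /teval_r_bil /=.
- by rewrite scalerDr !scalerA mulrC.
- by rewrite linearP /= scalerDl scalerA.
Qed.

HB.instance Definition _ := bilinear_isBilinear.Build k A V V *:%R *:%R
  teval_l_bil teval_l_bil_is_bilinear.
HB.instance Definition _ := bilinear_isBilinear.Build k V A V *:%R *:%R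
  teval_r_bil teval_r_bil_is_bilinear.

Definition teval_l : A ⊗ V -> V := tlift teval_l_bil.
Definition teval_r : V ⊗ A -> V := tlift teval_r_bil.
HB.instance Definition _ := GRing.Linear.copy teval_l (tlift teval_l_bil).
HB.instance Definition _ := GRing.Linear.copy teval_r (tlift teval_r_bil).

Lemma teval_lE a v : teval_l (a ⊗ₜ v) = (f a : k) *: v.
Proof. exact: tlift_tens. Qed.

Lemma teval_rE a v : teval_r (v ⊗ₜ a) = (f a : k) *: v.
Proof. exact: tlift_tens. Qed.

End Forms.

Section Multiplication.
Variables (k : fieldType) (A : algType k).

Definition mul_bil (a b : A) : A := a * b.

Fact mul_bil_is_bilinear : bilinear_for *:%R *:%R mul_bil.
Proof.
split=> w a x y; rewrite /mul_bil /=.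
- by rewrite mulrDl scalerAl.
- by rewrite mulrDr scalerAr.
Qed.

HB.instance Definition _ := bilinear_isBilinear.Build k A A A *:%R *:%R
  mul_bil mul_bil_is_bilinear.

Definition mu : A ⊗ A -> A := tlift mul_bil.
HB.instance Definition _ := GRing.Linear.copy mu (tlift mul_bil).

Lemma muE a b : mu (a ⊗ₜ b) = a * b.
Proof. exact: tlift_tens. Qed.

End Multiplication.

Arguments mu {k A}.

(* [pass_l s] is (s ⊗ B)(A ⊗ s) and [pass_r s] is (B ⊗ s)(s ⊗ B), for
   s : A ⊗ B -> B ⊗ A, up to associators. *)
Section Pass.
Variables (k : fieldType).

Definition pass_l (A V : lmodType k) (s : {linear A ⊗ V -> V ⊗ A}) :
    A ⊗ (A ⊗ V) -> V ⊗ (A ⊗ A) :=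
  @tassoc k V A A \o tmap s idfun \o @tassocV k A V A \o tmap idfun s.

Definition pass_r (A V : lmodType k) (s : {linear V ⊗ A -> A ⊗ V}) :
    (V ⊗ A) ⊗ A -> (A ⊗ A) ⊗ V :=
  @tassocV k A A V \o tmap idfun s \o @tassoc k A V A \o tmap s idfun.

(* A ⊗ c ⊗ D *)
Definition tmid (A B C D : lmodType k) (c : {linear B ⊗ C -> C ⊗ B}) :
    (A ⊗ B) ⊗ (C ⊗ D) -> (A ⊗ C) ⊗ (B ⊗ D) :=
  @tassocV k A C (B ⊗ D)
  \o tmap idfun (@tassoc k C B D \o tmap c idfun \o @tassocV k B C D)
  \o @tassoc k A B (C ⊗ D).

End Pass.

Section BraidedHopf.
Variable k : fieldType.

Record braidedBialgebra := BraidedBialgebra {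
  bb_alg :> algType k;
  Delta : {linear bb_alg -> bb_alg ⊗ bb_alg};
  eps : {linear bb_alg -> k^o};
  braid : {linear bb_alg ⊗ bb_alg -> bb_alg ⊗ bb_alg};

  Delta_coassoc : forall h,
    tassoc (tmap Delta idfun (Delta h)) = tmap idfun Delta (Delta h);
  Delta_counit_l : forall h, teval_l eps (Delta h) = h;
  Delta_counit_r : forall h, teval_r eps (Delta h) = h;

  braid_bij : bijective braid;
  braid_eq : forall t : (bb_alg ⊗ bb_alg) ⊗ bb_alg,
    pass_l braid (tassoc (tmap braid idfun t)) =
    tmap idfun braid (pass_l braid (tassoc t));

  braid_1_l : forall h, braid (1 ⊗ₜ h) = h ⊗ₜ 1;
  braid_1_r : forall h, braid (h ⊗ₜ 1) = 1 ⊗ₜ h;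
  braid_mu_l : forall t : (bb_alg ⊗ bb_alg) ⊗ bb_alg,
    braid (tmap mu idfun t) = tmap idfun mu (pass_l braid (tassoc t));
  braid_mu_r : forall t : bb_alg ⊗ (bb_alg ⊗ bb_alg),
    braid (tmap idfun mu t) = tmap mu idfun (pass_r braid (tassocV t));
  braid_eps_l : forall t, teval_r eps (braid t) = teval_l eps t;
  braid_eps_r : forall t, teval_l eps (braid t) = teval_r eps t;
  braid_Delta_l : forall t : bb_alg ⊗ bb_alg,
    tmap idfun Delta (braid t) = pass_l braid (tassoc (tmap Delta idfun t));
  braid_Delta_r : forall t : bb_alg ⊗ bb_alg,
    tmap Delta idfun (braid t) = pass_r braid (tassocV (tmap idfun Delta t));

  eps_1 : eps 1 = 1;
  eps_mul : forall g h, eps (g * h) = (eps g : k) * eps h;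
  Delta_1 : Delta 1 = 1 ⊗ₜ 1;
  Delta_mu : forall t : bb_alg ⊗ bb_alg,
    Delta (mu t) = tmap mu mu (tmid braid (tmap Delta Delta t))
}.

Record braidedHopf := BraidedHopf {
  bh_bialg :> braidedBialgebra;
  antipode : {linear bh_bialg -> bh_bialg};
  antipode_l : forall h : bh_bialg,
    mu (tmap antipode idfun (Delta bh_bialg h)) = (eps bh_bialg h : k) *: 1;
  antipode_r : forall h : bh_bialg,
    mu (tmap idfun antipode (Delta bh_bialg h)) = (eps bh_bialg h : k) *: 1
}.

End BraidedHopf.

Arguments Delta {k b}.
Arguments eps {k b}.
Arguments braid {k b}.

Section Comodules.
Variables (k : fieldType) (H : braidedBialgebra k) (V : lmodType k).

Record is_left_space (s : {linear H ⊗ V -> V ⊗ H}) : Prop := {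
  ls_bij : bijective s;
  ls_1 : forall v, s (1 ⊗ₜ v) = v ⊗ₜ 1;
  ls_mu : forall t : (H ⊗ H) ⊗ V,
    s (tmap mu idfun t) = tmap idfun mu (pass_l s (tassoc t));
  ls_eps : forall t, teval_r eps (s t) = teval_l eps t;
  ls_Delta : forall t : H ⊗ V,
    tmap idfun Delta (s t) = pass_l s (tassoc (tmap Delta idfun t));
  ls_braid : forall t : (H ⊗ H) ⊗ V,
    pass_l s (tassoc (tmap braid idfun t)) =
    tmap idfun braid (pass_l s (tassoc t))
}.

Record is_right_comodule (s : {linear H ⊗ V -> V ⊗ H})
    (nu : {linear V -> V ⊗ H}) : Prop := {
  rc_left_space : is_left_space s;
  rc_coassoc : forall v,
    tassoc (tmap nu idfun (nu v)) = tmap idfun Delta (nu v);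
  rc_counit : forall v, teval_r eps (nu v) = v;
  rc_braid : forall t : H ⊗ V,
    tassoc (tmap nu idfun (s t)) =
    tmap idfun braid (tassoc (tmap s idfun (tassocV (tmap idfun nu t))))
}.

End Comodules.

Section QNumbers.
Variable k : fieldType.

Definition qnat (t : k) (j : nat) : k := \sum_(i < j) t ^+ i.
Definition qfact (t : k) (j : nat) : k := \prod_(i < j) qnat t i.+1.

End QNumbers.

Section Data.
Variables (k : fieldType) (gT : finGroupType).
Variables (chi : gT -> k) (z : gT) (lam q : k) (n : nat).

Definition is_character : Prop :=
  (forall g, chi g != 0) /\ {morph chi : g h / (g * h)%g >-> g * h}.

(* The group algebra k[G] is the space of functions on G. *)
Definition grp_elt (g : gT) : {ffun gT -> k^o} := [ffun h => (h == g)%:R].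

Definition lam_zn : {ffun gT -> k^o} := lam *: (grp_elt (z ^+ n) - grp_elt 1).

Definition is_HD_datum : Prop :=
  [/\ is_character,
      z \in 'Z([set: gT])%g,
      q != 0,
      (1 < n)%N && n.-primitive_root (q * chi z)
    & lam_zn != 0 -> forall g, chi g ^+ n = 1].

(* H is H_D: iota is the embedding of G and x the remaining generator.  The
   relations and the basis together say that H is the algebra so presented. *)
Record is_HD (H : braidedHopf k) (iota : gT -> H) (x : H) : Prop := {
  hd_1 : iota 1%g = 1;
  hd_mul : {morph iota : g h / (g * h)%g >-> g * h};
  hd_xn : x ^+ n = lam *: (iota (z ^+ n)%g - 1);
  hd_xg : forall g, x * iota g = chi g *: (iota g * x);
  hd_basis : forall h : H, exists! a : {ffun gT * 'I_n -> k},
    h = \sum_b a b *: (iota b.1 * x ^+ b.2);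
  hd_Delta_g : forall g, Delta (iota g) = iota g ⊗ₜ iota g;
  hd_Delta_x : Delta x = 1 ⊗ₜ x + x ⊗ₜ iota z;
  hd_eps_g : forall g, eps (iota g) = 1;
  hd_eps_x : eps x = 0;
  hd_braid : forall (g h : gT) (i j : 'I_n),
    braid ((iota g * x ^+ i) ⊗ₜ (iota h * x ^+ j)) =
    q ^+ (i * j) *: ((iota h * x ^+ j) ⊗ₜ (iota g * x ^+ i))
}.

Definition aut_chi_z : {set {perm gT}} :=
  [set phi in Aut [set: gT] | (phi z == z) && [forall g, chi (phi g) == chi g]].

Fact aut_chi_z_group_set : group_set aut_chi_z.
Proof.
apply/group_setP; split=> [|phi psi].
  rewrite inE group1 perm1 eqxx /=.
  by apply/forallP=> g; rewrite perm1.
rewrite !(in_set (fun phi => [&& phi \in Aut _, _ & _])) => /and3P[Aphi /eqP phiz /forallP chiphi].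
move=> /and3P[Apsi /eqP psiz /forallP chipsi].
rewrite (groupM Aphi Apsi) permM phiz psiz eqxx /=; apply/forallP=> g.
by rewrite permM (eqP (chipsi _)) (eqP (chiphi _)).
Qed.

Canonical aut_chi_z_group := Group aut_chi_z_group_set.

Definition aut_type := {phi : {perm gT} | phi \in aut_chi_z}.

Section Gradation.
Variables (V : lmodType k).

Definition is_gradation (I : finType) (W : I -> {pred V}) : Prop :=
  (forall i, submod_closed (W i)) /\
  forall v, exists! f : {ffun I -> V},
    (forall i, f i \in W i) /\ v = \sum_i f i.

Variable W : gT * aut_type -> {pred V}.

(* V_zeta and V_g *)
Definition in_V_aut (zeta : aut_type) (v : V) : Prop :=
  exists2 f : gT -> V, forall g, f g \in W (g, zeta) & v = \sum_g f g.

Definition in_V_grp (g : gT) (v : V) : Prop :=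
  exists2 f : aut_type -> V,
    forall zeta, f zeta \in W (g, zeta) & v = \sum_zeta f zeta.

Record is_comodule_datum (alpha U : {linear V -> V}) : Prop := {
  cd_grad : is_gradation W;
  cd_alpha_bij : bijective alpha;
  cd_alpha_n : lam_zn != 0 -> forall v, iter n alpha v = v;
  cd_alpha_W : forall i v, v \in W i <-> exists2 w, w \in W i & v = alpha w;
  cd_U_alpha : forall v, U (alpha v) = q *: alpha (U v);
  cd_U_n : forall v, iter n U v = 0;
  cd_U_W : forall g zeta v, v \in W (g, zeta) -> U v \in W ((g * z^-1)%g, zeta)
}.

Variables (H : braidedHopf k) (iota : gT -> H) (x : H).

Definition is_transposition_of (alpha : {linear V -> V})
    (s : {linear H ⊗ V -> V ⊗ H}) : Prop :=
  forall (g : gT) (i : 'I_n) (zeta : aut_type) (v : V), in_V_aut zeta v ->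
    s ((iota g * x ^+ i) ⊗ₜ v) =
    iter i alpha v ⊗ₜ (iota (val zeta g) * x ^+ i).

Definition is_coaction_of (U : {linear V -> V})
    (nu : {linear V -> V ⊗ H}) : Prop :=
  forall (g : gT) (v : V), in_V_grp g v ->
    nu v = \sum_(j < n) (qfact (q * chi z) j)^-1 *:
             (iter j U v ⊗ₜ (iota (z ^- j * g)%g * x ^+ j)).

End Gradation.

End Data.

(* Main.v *)
(* Writing t = q p, one has Δ(g x^i) = \sum_j [i choose j]_t g x^j ⊗ g z^j x^(i-j), with
   nonzero t-binomials for i < n; so a coaction of H on V is a G-gradation with an
   operator U of degree z^-1 such that U^n = 0.
   For a transposition s, each map s(a ⊗ -), a in G, is such a coaction, and
   compatibility with the braid makes the coefficients of all these coactions and of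
   s(x ⊗ -) q-commute.  Hence the operator D_a attached to s(a ⊗ -) vanishes: if
   z <> 1 because its degree z^-1 must be trivial; if z = 1 because s(x ⊗ v) = α(v) ⊗ x
   and α D_a = q D_a α = q^2 α D_a, where q^2 <> 1 unless (p, q) = (1, -1).  So V
   splits into simultaneous eigenspaces, on which s(a ⊗ v) = v ⊗ ζ(a).  In general
   s(x ⊗ v) = α(v) ⊗ x plus a part of degree 0 in x, governed by an operator β.
   The relation x a = χ(a) a x gives β = χ(a) β, so β = 0 unless χ = 1, and in that
   case p = 1, β^2 = α β = 0, whence s(x ⊗ β(v)) = 0 and again β = 0.  Injectivity of s
   then forces ζ to be an automorphism fixing z and χ. *)
From HB Require Import structures.
Require Import Defs.
From mathcomp Require Import all_boot all_order all_fingroup all_algebra center.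
From mathcomp Require Import boolp ring.

Set Implicit Arguments.
Unset Strict Implicit.
Unset Printing Implicit Defensive.

Import GRing.Theory.
Local Open Scope ring_scope.

(** * Arithmetic of pure tensors, and evaluation of linear forms on tensor factors *)

Section TensorForms.
Variable k : fieldType.

Definition lin (U V : lmodType k) (f : U -> V) (hf : linear f) : {linear U -> V} :=
  HB.pack f (GRing.isLinear.Build k U V *:%R f hf).

Lemma scale_regE (a : k) (b : k^o) : a *: b = (a * b : k).
Proof. by []. Qed.

(* The linear form f ⊗ f' on A ⊗ B. *)
Definition tform (A B : lmodType k) (f : {linear A -> k^o}) (f' : {linear B -> k^o})
    (t : A ⊗ B) : k^o := f' (teval_l f t).
HB.instance Definition _ A B f f' :=
  GRing.Linear.copy (@tform A B f f') (f' \o teval_l f).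

Section TensorArith.
Variables (U V : lmodType k).
Implicit Types (u : U) (v : V).

Lemma tens0l v : (0 : U) ⊗ₜ v = 0. Proof. exact: (linear0 (tensr v)). Qed.
Lemma tens0r u : u ⊗ₜ (0 : V) = 0. Proof. exact: (linear0 (tensl u)). Qed.
Lemma tensDl u u' v : (u + u') ⊗ₜ v = u ⊗ₜ v + u' ⊗ₜ v.
Proof. exact: (linearD (tensr v)). Qed.
Lemma tensDr u v v' : u ⊗ₜ (v + v') = u ⊗ₜ v + u ⊗ₜ v'.
Proof. exact: (linearD (tensl u)). Qed.
Lemma tensZl c u v : (c *: u) ⊗ₜ v = c *: (u ⊗ₜ v).
Proof. exact: (linearZZ (tensr v)). Qed.
Lemma tensZr c u v : u ⊗ₜ (c *: v) = c *: (u ⊗ₜ v).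
Proof. exact: (linearZZ (tensl u)). Qed.
Lemma tens_suml I r (P : pred I) (F : I -> U) v :
  (\sum_(i <- r | P i) F i) ⊗ₜ v = \sum_(i <- r | P i) F i ⊗ₜ v.
Proof. exact: (linear_sum (tensr v)). Qed.
Lemma tens_sumr I r (P : pred I) (F : I -> V) u :
  u ⊗ₜ (\sum_(i <- r | P i) F i) = \sum_(i <- r | P i) u ⊗ₜ F i.
Proof. exact: (linear_sum (tensl u)). Qed.
End TensorArith.

Lemma tformE (A B : lmodType k) (f : {linear A -> k^o}) (f' : {linear B -> k^o}) a b :
  tform f f' (a ⊗ₜ b) = f a * f' b :> k.
Proof. by rewrite /tform teval_lE linearZ. Qed.

Lemma tform_sum (A B : lmodType k) (f : {linear A -> k^o}) (f' : {linear B -> k^o})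
    I r (P : pred I) (F : I -> A ⊗ B) :
  tform f f' (\sum_(i <- r | P i) F i) = \sum_(i <- r | P i) (tform f f' (F i) : k).
Proof. exact: (linear_sum (tform f f')). Qed.

Lemma tformZ (A B : lmodType k) (f : {linear A -> k^o}) (f' : {linear B -> k^o}) c u :
  tform f f' (c *: u) = (c * tform f f' u : k).
Proof. exact: (linearZZ (tform f f')). Qed.

Lemma eq_teval_r (A V : lmodType k) (f f' : {linear A -> k^o}) (t : V ⊗ A) :
  f =1 f' -> teval_r f t = teval_r f' t.
Proof.
move=> ff'; apply: (tens_ext (f := teval_r f) (g := teval_r f')) => v a.
by rewrite /= !teval_rE ff'.
Qed.

Lemma teval_r_map (A B V : lmodType k) (Phi : {linear A -> B}) (f : {linear B -> k^o})
    (t : V ⊗ A) : teval_r f (tmap idfun Phi t) = teval_r (f \o Phi) t.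
Proof.
apply: (tens_ext (f := teval_r f \o tmap idfun Phi) (g := teval_r (f \o Phi))) => v a.
by rewrite /= tmapE !teval_rE.
Qed.

(** The two forms act on different factors, so [f'] may be evaluated before [phi] is applied. This
    turns the comodule axioms, stated in [V ⊗ (H ⊗ H)], into identities between compositions of
    operators on [V]. *)
Lemma teval_r_tassoc (U V A B : lmodType k) (f : {linear A -> k^o})
    (f' : {linear B -> k^o}) (phi : {linear U -> V ⊗ A}) (t : U ⊗ B) :
  teval_r (tform f f') (tassoc (tmap phi idfun t)) = teval_r f (phi (teval_r f' t)).
Proof.
elim/tens_ind: t => [|u b|t t' IH IH']; rewrite ?linear0 // ?linearD.
  rewrite tmapE /= teval_rE linearZ /=.
  elim/tens_ind: (phi u) => [|v a|t t' IH IH'].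
  - by rewrite tens0l scaler0 !linear0.
  - by rewrite tassocE linearZ /= !teval_rE /= tformE scalerA mulrC.
  - by rewrite tensDl scalerDr !linearD /= IH IH'.
by rewrite /= IH IH'.
Qed.

Lemma teval_r_pass (A V B B' : lmodType k) (f : {linear B' -> k^o})
    (f' : {linear B -> k^o}) (s : {linear A ⊗ V -> V ⊗ B'}) a (t : V ⊗ B) :
  teval_r (tform f f') (tassoc (tmap s idfun (tassocV (a ⊗ₜ t)))) =
  teval_r f (s (a ⊗ₜ teval_r f' t)).
Proof.
rewrite -(teval_r_tassoc f f' (s \o tensl a) t); congr (teval_r _ (tassoc _)).
elim/tens_ind: t => [|v b|t t' IH IH']; first by rewrite tens0r !linear0.
- by rewrite tassocVE !tmapE.
- by rewrite tensDr !linearD /= IH IH'.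
Qed.

HB.instance Definition _ (A V : lmodType k) (s : {linear A ⊗ V -> V ⊗ A}) :=
  GRing.Linear.copy (pass_l s)
    (@tassoc k V A A \o tmap s idfun \o @tassocV k A V A \o tmap idfun s).

End TensorForms.

Arguments pass_l : simpl never.
Arguments tform : simpl never.

(** * q-binomial coefficients *)

Section QBinomials.
Variables (k : fieldType) (t : k).

(** These are the Gaussian binomials, in the form of Pascal's rule that right multiplication by Δ(x)
    produces. The truncated subtraction is harmless: for i' < j' the factor [qbin i' j'] is 0. *)
Fixpoint qbin (i j : nat) : k :=
  match i, j with
  | _, 0 => 1
  | 0, _.+1 => 0
  | i'.+1, j'.+1 => qbin i' j + t ^+ (i' - j') * qbin i' j'
  end.

Lemma qbin0 i : qbin i 0 = 1. Proof. by case: i. Qed.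

Lemma qbin_small i j : (i < j)%N -> qbin i j = 0.
Proof.
elim: i j => [|i IH] [|j] //= ij.
by rewrite !IH ?mulr0 ?addr0 // ltnW.
Qed.

Lemma qfactS j : qfact t j.+1 = qfact t j * qnat t j.+1.
Proof. by rewrite /qfact big_ord_recr. Qed.

Lemma qfact0 : qfact t 0 = 1. Proof. by rewrite /qfact big_ord0. Qed.

Lemma qnatD a b : qnat t (a + b) = qnat t a + t ^+ a * qnat t b.
Proof.
rewrite /qnat big_split_ord mulr_sumr; congr (_ + _).
by apply: eq_bigr => i _; rewrite exprD.
Qed.

(** The product form needs no division, so it holds for every [t]. The induction splits (i+1)_t as
    (i-j)_t + t^(i-j) (j+1)_t, one summand for each term of Pascal's rule. *)
Lemma qbin_fact i j : (j <= i)%N -> qbin i j * qfact t j * qfact t (i - j) = qfact t i.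
Proof.
elim: i j => [|i IH] [|j] //=; rewrite ?qfact0 ?mul1r ?subn0 //.
rewrite ltnS subSS => ji; rewrite !mulrDl !qfactS.
have -> : qbin i j.+1 * (qfact t j * qnat t j.+1) * qfact t (i - j) =
          qfact t i * qnat t (i - j).
  have [ij|ij] := ltnP j i; last first.
    (* At the boundary j = i both sides vanish: the binomial is 0 on the left, and (0)_t = 0 on the
       right. *)
    by rewrite qbin_small // /qnat (eqP ij) big_ord0 !(mulr0, mul0r).
  by rewrite -(IH j.+1 ij) -(subnSK ij) !qfactS !mulrA.
have -> : qnat t i.+1 = qnat t (i - j) + t ^+ (i - j) * qnat t j.+1.
  by rewrite -qnatD addnS subnK.
by rewrite -(IH j ji); ring.
Qed.
End QBinomials.

(** * The structure of H in the basis g x^i *)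

Section KropHopf.
Variables (k : fieldType) (gT : finGroupType).
Variables (chi : gT -> k) (z : gT) (lam q : k) (n : nat).
Hypothesis hD : is_HD_datum chi z lam q n.
Variables (H : braidedHopf k) (iota : gT -> H) (x : H).
Hypothesis hH : is_HD chi z lam q n iota x.

Local Notation t := (q * chi z).

Lemma n_gt1 : (1 < n)%N.
Proof. by case: hD => _ _ _ /andP[]. Qed.

Lemma n_gt0 : (0 < n)%N.
Proof. exact: ltnW n_gt1. Qed.

Lemma chi_neq0 g : chi g != 0.
Proof. by case: hD => -[]. Qed.

Lemma chiM g h : chi (g * h)%g = chi g * chi h.
Proof. by case: hD => -[_ ->]. Qed.

Lemma chi1 : chi 1%g = 1.
Proof. by apply: (mulfI (chi_neq0 1)); rewrite -chiM mulg1 mulr1. Qed.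

Lemma zC g : commute z g.
Proof. by case: hD => _ /centerP[_ zC] _ _ _; apply: zC; rewrite inE. Qed.

(** Since t^j - 1 = (t - 1) (j)_t, a zero of (j)_t would give t^j = 1 with 0 < j < n, against the
    order of t. *)
Lemma qnat_neq0 j : (0 < j < n)%N -> qnat t j != 0.
Proof.
case: hD => _ _ _ /andP[_ tn] _ /andP[j0 jn].
apply/negP => /eqP t0; have := subrX1 t j; rewrite -/(qnat t j) t0 mulr0.
move/eqP; rewrite subr_eq0 -(prim_order_dvd tn) => /(dvdn_leq j0).
by rewrite leqNgt jn.
Qed.

Lemma qfact_neq0 j : (j < n)%N -> qfact t j != 0.
Proof.
move=> jn; apply/prodf_neq0 => i _; apply: qnat_neq0.
exact: leq_ltn_trans (ltn_ord i) jn.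
Qed.

Lemma qbin_neq0 i j : (j <= i < n)%N -> qbin t i j != 0.
Proof.
move=> /andP[ji iN]; apply: contraNneq (qfact_neq0 iN) => b0.
by rewrite -(qbin_fact t ji) b0 !mul0r.
Qed.

Definition ex (g : gT) (i : nat) : H := iota g * x ^+ i.

Lemma exE g : ex g 0 = iota g. Proof. exact: mulr1. Qed.
Lemma ex1 : ex 1 0 = 1. Proof. by rewrite exE (hd_1 hH). Qed.
Lemma ex1X i : ex 1 i = x ^+ i. Proof. by rewrite /ex (hd_1 hH) mul1r. Qed.
Lemma exx : ex 1 1 = x. Proof. exact: ex1X. Qed.

Lemma exM g i h j : ex g i * ex h j = chi h ^+ i *: ex (g * h)%g (i + j).
Proof.
have xh m : x ^+ m * iota h = chi h ^+ m *: (iota h * x ^+ m).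
  elim: m => [|m IH]; first by rewrite !expr0 mul1r mulr1 scale1r.
  by rewrite exprSr -mulrA (hd_xg hH) -scalerAr (mulrA (x ^+ m)) IH -scalerAl scalerA -mulrA
             -exprSr -exprS.
by rewrite /ex -mulrA [X in _ * X]mulrA xh -scalerAl -scalerAr exprD (hd_mul hH) !mulrA.
Qed.

Lemma braid_ex g i h j : (i < n)%N -> (j < n)%N ->
  braid (ex g i ⊗ₜ ex h j) = q ^+ (i * j) *: (ex h j ⊗ₜ ex g i).
Proof. by move=> iN jN; exact: (hd_braid hH g h (Ordinal iN) (Ordinal jN)). Qed.

(* The dual basis of [ex g i], extended by zero to the exponents i >= n. *)
Definition hcoord (h : H) : {ffun gT * 'I_n -> k} := sval (cid (hd_basis hH h)).

Definition cx (g : gT) (i : nat) (h : H) : k^o :=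
  if insub i is Some j then hcoord h (g, j) else 0.

Lemma hcoordE h : h = \sum_b hcoord h b *: ex b.1 b.2.
Proof. by case: (svalP (cid (hd_basis hH h))). Qed.

Lemma hcoord_uniq h (a : {ffun gT * 'I_n -> k}) :
  h = \sum_b a b *: ex b.1 b.2 -> hcoord h = a.
Proof. by case: (svalP (cid (hd_basis hH h))) => _; apply. Qed.

Lemma cx_is_linear g i : linear (cx g i).
Proof.
move=> c u v; rewrite /cx; case: insubP => [j _ _|_]; last by rewrite scaler0 addr0.
have -> : hcoord (c *: u + v) = [ffun b => c * hcoord u b + hcoord v b].
  apply: hcoord_uniq; rewrite {1}[u]hcoordE {1}[v]hcoordE scaler_sumr -big_split.
  by apply: eq_bigr => b _; rewrite ffunE scalerDl scalerA.
by rewrite ffunE.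
Qed.

HB.instance Definition _ g i :=
  GRing.isLinear.Build k H k^o *:%R (cx g i) (cx_is_linear g i).

Lemma cx_ge g i h : (n <= i)%N -> cx g i h = 0.
Proof. by move=> ni; rewrite /cx insubF // ltnNge ni. Qed.

Lemma cx_ex g i g' i' : (i' < n)%N ->
  cx g i (ex g' i') = ((g == g') && (i == i'))%:R.
Proof.
move=> iN; rewrite /cx; case: insubP => [j _ <-|]; last first.
  by case: (eqVneq i i') => [->|_]; rewrite ?andbF // iN.
have -> : hcoord (ex g' i') = [ffun b => (b == (g', Ordinal iN))%:R].
  apply: hcoord_uniq; rewrite (bigD1 (g', Ordinal iN)) //= ffunE eqxx scale1r.
  by rewrite big1 ?addr0 // => b /negPf nb; rewrite ffunE nb scale0r.
by rewrite ffunE xpair_eqE.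
Qed.

Lemma cx_sum h : h = \sum_g \sum_(i < n) cx g i h *: ex g i.
Proof.
rewrite {1}[h]hcoordE pair_big; apply: eq_bigr => -[g i] _ /=.
by rewrite /cx valK.
Qed.

Lemma H_ext (W : lmodType k) (f f' : {linear H -> W}) :
  (forall g i, (i < n)%N -> f (ex g i) = f' (ex g i)) -> f =1 f'.
Proof.
move=> ff' h; rewrite [h]cx_sum !linear_sum; apply: eq_bigr => g _.
by rewrite !linear_sum; apply: eq_bigr => i _; rewrite !linearZ ff'.
Qed.

Lemma cx_tens_sum (V : lmodType k) (u : V ⊗ H) :
  u = \sum_g \sum_(i < n) teval_r (cx g i) u ⊗ₜ ex g i.
Proof.
elim/tens_ind: u => [|v h|u u' IH IH'].
- by rewrite big1 // => g _; rewrite big1 // => i _; rewrite linear0 tens0l.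
- rewrite {1}[h]cx_sum tens_sumr; apply: eq_bigr => g _.
  rewrite tens_sumr; apply: eq_bigr => i _.
  by rewrite teval_rE tensZl tensZr.
- rewrite {1}IH {1}IH' -big_split; apply: eq_bigr => g _.
  by rewrite -big_split; apply: eq_bigr => i _; rewrite linearD tensDl.
Qed.

Lemma eps_ex g i : eps (ex g i) = (i == 0)%:R.
Proof.
rewrite /ex eps_mul (hd_eps_g hH) mul1r.
case: i => [|i]; first exact: eps_1.
by rewrite exprS eps_mul (hd_eps_x hH) mul0r.
Qed.

(* The multiplication of the braided tensor square of H. *)
Definition mu2 (u : (H ⊗ H) ⊗ (H ⊗ H)) : H ⊗ H := tmap mu mu (tmid braid u).
HB.instance Definition _ := GRing.Linear.copy mu2 (tmap mu mu \o tmid braid).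

Lemma mu2_tens (a b c d : H) r : braid (b ⊗ₜ c) = r *: (c ⊗ₜ b) ->
  mu2 ((a ⊗ₜ b) ⊗ₜ (c ⊗ₜ d)) = r *: ((a * c) ⊗ₜ (b * d)).
Proof.
move=> bc; rewrite /mu2 /tmid /= tassocE tmapE /= tassocVE tmapE /= bc.
by rewrite tensZl linearZ /= tassocE tensZr !linearZ /= tassocVE tmapE /= !muE.
Qed.

Lemma DeltaM (a b : H) :
  Delta (a * b) = mu2 (Delta a ⊗ₜ Delta b).
Proof. by rewrite -muE Delta_mu tmapE. Qed.

(** The q-binomial formula for (1 ⊗ x + x ⊗ z)^i, by induction through right multiplication by
    Δ(x). *)
Lemma Delta_exp i : (i < n)%N ->
  Delta (x ^+ i) = \sum_(j < i.+1) qbin t i j *: (ex 1 j ⊗ₜ ex (z ^+ j) (i - j)).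
Proof.
elim: i => [|i IH] iN.
  by rewrite big_ord1 scale1r expg0 subnn ex1 Delta_1.
rewrite exprSr DeltaM IH ?(ltnW iN) // (hd_Delta_x hH).
pose F j := ex 1 j ⊗ₜ ex (z ^+ j) (i.+1 - j).
have -> : mu2 ((\sum_(j < i.+1) qbin t i j *: (ex 1 j ⊗ₜ ex (z ^+ j) (i - j)))
                 ⊗ₜ (1 ⊗ₜ x + x ⊗ₜ iota z)) =
    \sum_(j < i.+1) (qbin t i j *: F j + t ^+ (i - j) * qbin t i j *: F j.+1).
  rewrite tens_suml (linear_sum mu2); apply: eq_bigr => j _ /=.
  have jn m : (m <= i)%N -> (m < n)%N by move=> mi; apply: leq_ltn_trans mi (ltnW iN).
  rewrite tensZl tensDr (linearZ_LR mu2) (linearD mu2) /= scalerDr.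
  rewrite (@mu2_tens _ _ _ _ 1) ?braid_1_r ?scale1r //.
  (* Braiding x^(i-j) past x costs q^(i-j), and commuting it past z costs p^(i-j); together they
     give the factor t^(i-j) of Pascal's rule. *)
  rewrite (@mu2_tens _ _ _ _ (q ^+ (i - j))); last first.
    by have := braid_ex (z ^+ j) 1 (jn _ (leq_subr j i)) n_gt1; rewrite exx muln1.
  rewrite -!exx !exM -(exE z) !exM chi1 !expr1n !scale1r. rewrite !mulg1 addn0 !addn1.
  have ji : (j <= i)%N by rewrite -ltnS.
  rewrite (mulr1 (ex 1 j)) tensZr !scalerA /F subSS (subSn ji) expgSr.
  by congr (_ + _ *: _); rewrite exprMn; ring.
rewrite big_split [RHS]big_ord_recl /=.
have -> : \sum_(j < i.+1) (qbin t i (bump 0 j) + t ^+ (i - (0 + j)) * qbin t i (0 + j))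
        *: (ex 1 (bump 0 j) ⊗ₜ ex (z ^+ bump 0 j) (i.+1 - bump 0 j)) =
    \sum_(j < i.+1) qbin t i j.+1 *: F j.+1 +
    \sum_(j < i.+1) t ^+ (i - j) * qbin t i j *: F j.+1.
  by rewrite -big_split; apply: eq_bigr => j _; rewrite /= -scalerDl.
rewrite addrA; congr (_ + _).
transitivity (\sum_(j < i.+2) qbin t i j *: F j).
  by rewrite [RHS]big_ord_recr /= (qbin_small t (ltnSn i)) scale0r addr0.
by rewrite big_ord_recl /= qbin0.
Qed.

Lemma Delta_ex g i : (i < n)%N ->
  Delta (ex g i) = \sum_(j < i.+1) qbin t i j *: (ex g j ⊗ₜ ex (g * z ^+ j)%g (i - j)).
Proof.
move=> iN; rewrite {1}/ex DeltaM (hd_Delta_g hH) Delta_exp // tens_sumr (linear_sum mu2).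
apply: eq_bigr => j _ /=; rewrite tensZr (linearZ_LR mu2) /=; congr (_ *: _).
rewrite (@mu2_tens _ _ _ _ 1); last first.
  have jn : (j < n)%N by apply: leq_ltn_trans iN; rewrite -ltnS.
  by have := braid_ex g 1 n_gt0 jn; rewrite exE mul0n expr0.
by rewrite scale1r -(exE g) !exM !expr0 !scale1r mulg1 !add0n.
Qed.

(** The dual of [Delta_ex]: the convolution product of two coordinate forms. No bound on the
    exponents is required, since [cx] is zero from exponent n on. *)
Lemma tform_Delta g i g' i' h :
  tform (cx g i) (cx g' i') (Delta h) =
  ((g' == g * z ^+ i)%g%:R * qbin t (i + i') i * cx g (i + i') h : k).
Proof.
pose c := (g' == g * z ^+ i)%g%:R * qbin t (i + i') i.
apply: (H_ext (f := tform (cx g i) (cx g' i') \o Delta) (f' := c \*: cx g (i + i'))).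
move=> a m mN; rewrite /= (Delta_ex a mN) tform_sum /=.
have jn (j : 'I_m.+1) : (j < n)%N by apply: leq_trans mN; apply: ltn_ord.
rewrite (eq_bigr (fun j : 'I_m.+1 => qbin t m j * ((g == a) && (i == j))%:R *
    ((g' == a * z ^+ j)%g && (i' == m - j)%N)%:R)); last first.
  move=> j _; rewrite tformZ tformE /= !cx_ex ?mulrA //.
  by apply: leq_ltn_trans (leq_subr _ _) mN.
rewrite /c scale_regE cx_ex //.
have [<-|_] := eqVneq g a; last first.
  by rewrite big1 ?mulr0 // => j _; rewrite mulr0 mul0r.
have [im|mi] := ltnP i m.+1; last first.
  rewrite big1 => [|j _]; last first.
    by rewrite (gtn_eqF (leq_trans (ltn_ord j) mi)) mulr0 mul0r.
  have -> : (i + i' == m)%N = false by apply/negbTE; rewrite gtn_eqF ?ltn_addr.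
  by rewrite mulr0.
rewrite (bigD1 (Ordinal im)) //= big1 => [|j ji]; last first.
  suff -> : (i == j :> nat) = false by rewrite mulr0 mul0r.
  by apply: contraNF ji => /eqP ij; apply/eqP/val_inj.
rewrite addr0 eqxx mulr1 -(eqn_add2l i i' (m - i)) subnKC //.
have [<-|_] := eqVneq (i + i')%N m; last by rewrite andbF !mulr0.
by rewrite andbT mulr1 mulrC.
Qed.

Lemma tform_braid g i g' i' (u : H ⊗ H) :
  tform (cx g i) (cx g' i') (braid u) =
  (q ^+ (i * i') * tform (cx g' i') (cx g i) u : k).
Proof.
apply: (tens_ext (f := tform (cx g i) (cx g' i') \o braid)
  (g := q ^+ (i * i') \*: tform (cx g' i') (cx g i))) => h h' /=.
apply: (H_ext (f := tform (cx g i) (cx g' i') \o braid \o tensr h')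
  (f' := q ^+ (i * i') \*: (tform (cx g' i') (cx g i) \o tensr h'))) => a m mN /=.
apply: (H_ext (f := tform (cx g i) (cx g' i') \o braid \o tensl (ex a m))
  (f' := q ^+ (i * i') \*: (tform (cx g' i') (cx g i) \o tensl (ex a m)))) => b l lN /=.
rewrite /tensl braid_ex // tformZ /= !scale_regE !tformE /= !cx_ex //.
have [<-|_] := eqVneq i l; last by rewrite !(andbF, mul0r, mulr0).
have [<-|_] := eqVneq i' m; last by rewrite !(andbF, mul0r, mulr0).
by rewrite mulnC [X in _ * X]mulrC.
Qed.

Lemma teval_cx_inj (V : lmodType k) (u u' : V ⊗ H) :
  (forall g i, (i < n)%N -> teval_r (cx g i) u = teval_r (cx g i) u') -> u = u'.
Proof.
move=> uu'; rewrite [u]cx_tens_sum [u']cx_tens_sum; apply: eq_bigr => g _.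
by apply: eq_bigr => i _; rewrite uu'.
Qed.

Lemma teval_r_eps (V : lmodType k) (u : V ⊗ H) :
  teval_r eps u = \sum_g teval_r (cx g 0) u.
Proof.
rewrite {1}[u]cx_tens_sum linear_sum; apply: eq_bigr => g _ /=.
rewrite linear_sum (bigD1 (Ordinal n_gt0)) //= teval_rE eps_ex scale1r.
rewrite big1 ?addr0 // => i i0; rewrite teval_rE eps_ex.
suff -> : (i == 0 :> nat) = false by rewrite scale0r.
by apply: contraNF i0 => /eqP i0; apply/eqP/val_inj.
Qed.

Lemma cx_tens_ge (V : lmodType k) g i (u : V ⊗ H) : (n <= i)%N -> teval_r (cx g i) u = 0.
Proof.
move=> ni; elim/tens_ind: u => [|w c|u u' IH IH'].
- by rewrite linear0.
- by rewrite teval_rE /= cx_ge // scale0r.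
- by rewrite linearD /= IH IH' addr0.
Qed.

Lemma qbinn i : qbin t i i = 1.
Proof. by elim: i => //= i ->; rewrite qbin_small // subnn add0r mul1r. Qed.

Lemma teval_Delta (V : lmodType k) g i g' i' (u : V ⊗ H) :
  teval_r (tform (cx g i) (cx g' i')) (tmap idfun Delta u) =
  ((g' == g * z ^+ i)%g%:R * qbin t (i + i') i) *: teval_r (cx g (i + i')) u.
Proof.
rewrite teval_r_map; elim/tens_ind: u => [|v h|u u' IH IH'].
- by rewrite !linear0 ?scaler0.
- by rewrite !teval_rE /= tform_Delta scalerA.
- by rewrite !linearD /= IH IH' ?scalerDr.
Qed.

Lemma teval_braid (V : lmodType k) g i g' i' (u : V ⊗ (H ⊗ H)) :
  teval_r (tform (cx g i) (cx g' i')) (tmap idfun braid u) =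
  q ^+ (i * i') *: teval_r (tform (cx g' i') (cx g i)) u.
Proof.
rewrite teval_r_map; elim/tens_ind: u => [|v h|u u' IH IH'].
- by rewrite !linear0 ?scaler0.
- by rewrite !teval_rE /= tform_braid scalerA.
- by rewrite !linearD /= IH IH' ?scalerDr.
Qed.

Definition rmul (c h : H) : H := h * c.
Fact rmul_is_linear c : linear (rmul c).
Proof. by move=> a u v; rewrite /rmul mulrDl scalerAl. Qed.
HB.instance Definition _ c := GRing.isLinear.Build k H H *:%R (rmul c) (rmul_is_linear c).

Definition lmul (c h : H) : H := c * h.
Fact lmul_is_linear c : linear (lmul c).
Proof. by move=> a u v; rewrite /lmul mulrDr scalerAr. Qed.
HB.instance Definition _ c := GRing.isLinear.Build k H H *:%R (lmul c) (lmul_is_linear c).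

Lemma cx_rmul b i h : cx b i (rmul (iota b) h) = (chi b ^+ i * cx 1 i h : k).
Proof.
apply: (H_ext (f := cx b i \o rmul (iota b)) (f' := (chi b ^+ i) \*: cx 1 i)) => g j jn /=.
rewrite /rmul -(exE b) exM linearZ /= !scale_regE addn0 !cx_ex //.
have -> : (b == g * b)%g = (1%g == g).
  by rewrite -{1}[b]mul1g; exact: (inj_eq (mulIg b)).
have [->|] := eqVneq i j; first by [].
by rewrite !andbF !mulr0.
Qed.

Lemma cx_lmul b i h : cx b i (lmul (iota b) h) = cx 1 i h.
Proof.
apply: (H_ext (f := cx b i \o lmul (iota b)) (f' := cx 1 i)) => g j jn /=.
rewrite /lmul -(exE b) exM expr0 scale1r add0n !cx_ex //.
by congr ((_ && _)%:R); rewrite -{1}[b]mulg1; exact: (inj_eq (mulgI b)).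
Qed.

Lemma teval_cx_rmul (V : lmodType k) b i (u : V ⊗ H) :
  teval_r (cx b i) (tmap idfun (rmul (iota b)) u) = chi b ^+ i *: teval_r (cx 1 i) u.
Proof.
rewrite teval_r_map; elim/tens_ind: u => [|v h|u u' IH IH'].
- by rewrite !linear0 ?scaler0.
- by rewrite !teval_rE /= cx_rmul scalerA.
- by rewrite !linearD /= IH IH' ?scalerDr.
Qed.

Lemma teval_cx_lmul (V : lmodType k) b i (u : V ⊗ H) :
  teval_r (cx b i) (tmap idfun (lmul (iota b)) u) = teval_r (cx 1 i) u.
Proof. by rewrite teval_r_map; apply: eq_teval_r => h; exact: cx_lmul. Qed.

Lemma pass_l_tens (A V : lmodType k) (s : {linear A ⊗ V -> V ⊗ A}) a b c d u v w :
  s (b ⊗ₜ u) = v ⊗ₜ d -> s (a ⊗ₜ v) = w ⊗ₜ c ->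
  pass_l s (a ⊗ₜ (b ⊗ₜ u)) = w ⊗ₜ (c ⊗ₜ d).
Proof.
by move=> sb sa; rewrite /pass_l /= tmapE /= sb tassocVE tmapE /= sa tassocE.
Qed.

Lemma iter_is_linear (V : lmodType k) (f : {linear V -> V}) i : linear (iter i f).
Proof. by move=> c u v; elim: i => //= i ->; rewrite linearP. Qed.

Lemma iter_sum (V : lmodType k) (f : {linear V -> V}) m I r (P : pred I) (F : I -> V) :
  iter m f (\sum_(i <- r | P i) F i) = \sum_(i <- r | P i) iter m f (F i).
Proof. by elim: m => //= m ->; exact: linear_sum. Qed.

Lemma teval_tform_inj (V : lmodType k) (u u' : V ⊗ (H ⊗ H)) :
  (forall a i b j, (i < n)%N -> (j < n)%N ->
     teval_r (tform (cx a i) (cx b j)) u = teval_r (tform (cx a i) (cx b j)) u') ->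
  u = u'.
Proof.
have assocVK (w : V ⊗ (H ⊗ H)) : tassoc (tassocV w) = w.
  elim/tens_ind: w => [|v w|w w' IH IH']; first by rewrite !linear0.
    elim/tens_ind: w => [|g h|w w' IH IH']; first by rewrite tens0r !linear0.
      by rewrite tassocVE tassocE.
    by rewrite tensDr !linearD /= IH IH'.
  by rewrite !linearD /= IH IH'.
(* The inserted identity map gives [w] the shape expected by [teval_r_tassoc], with [phi] the
   identity of [V ⊗ H]. *)
have idE (w : V ⊗ (H ⊗ H)) : tassoc (tmap idfun idfun (tassocV w)) = w.
  rewrite -[RHS]assocVK; congr (tassoc _); elim/tens_ind: (tassocV w) => [|v h|y y' IH IH'].
  - by rewrite linear0.
  - by rewrite tmapE.
  - by rewrite linearD /= IH IH'.
move=> uu'; rewrite -[u]assocVK -[u']assocVK; congr (tassoc _).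
apply: teval_cx_inj => b j jN; apply: teval_cx_inj => a i iN.
have := uu' a i b j iN jN; rewrite -{1}[u]idE -{1}[u']idE.
by rewrite !teval_r_tassoc.
Qed.

Lemma ex_ge a i : (n <= i)%N ->
  ex a i = lam *: (ex (a * z ^+ n)%g (i - n) + (-1) *: ex a (i - n)).
Proof.
move=> ni; rewrite /ex -{1}(subnKC ni) exprD (hd_xn hH) -scalerAl -scalerAr.
by rewrite mulrBl mul1r mulrBr (hd_mul hH) scaleN1r !mulrA.
Qed.

(** The vanishing of λ(z^n - 1) in the group algebra means that z^n = 1 or λ = 0; in both cases x^n
    = 0. *)
Lemma ex_ge0 a i : lam_zn z lam n = 0 -> (n <= i)%N -> ex a i = 0.
Proof.
move=> lz ni; rewrite (ex_ge a ni).
have [zn|zn] := eqVneq (z ^+ n)%g 1%g; first by rewrite zn mulg1 scaleN1r subrr scaler0.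
have /ffunP/(_ (z ^+ n)%g) := lz; rewrite !ffunE eqxx (negPf zn) subr0 scale_regE mulr1.
by move=> ->; rewrite scale0r.
Qed.

(** * The comodule of a datum *)

Section Construction.
Variables (V : lmodType k) (W : gT * aut_type chi z -> {pred V}).
Variables (alpha U : {linear V -> V}).
Hypothesis dat : is_comodule_datum lam q n W alpha U.

(** * Homogeneous projections, and linear maps determined by homogeneous vectors *)

Definition pr (j : gT * aut_type chi z) (v : V) : V :=
  sval (cid ((cd_grad dat).2 v)) j.

Lemma pr_W j v : pr j v \in W j.
Proof. by rewrite /pr; case: cid => f [[]]. Qed.

Lemma pr_sum v : v = \sum_j pr j v.
Proof. by rewrite /pr; case: cid => f [[]]. Qed.

Lemma W_linear j c u v : u \in W j -> v \in W j -> c *: u + v \in W j.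
Proof. by have [_] := (cd_grad dat).1 j; apply. Qed.

Lemma W_0 j : 0 \in W j.
Proof. by have [] := (cd_grad dat).1 j. Qed.

Lemma pr_uniq (f : gT * aut_type chi z -> V) v :
  (forall j, f j \in W j) -> v = \sum_j f j -> forall j, pr j v = f j.
Proof.
move=> Wf vf j; rewrite /pr; case: cid => f' [_ f'_uniq] /=.
rewrite (f'_uniq (finfun f)) ?ffunE //; split=> [i|]; first by rewrite ffunE.
by rewrite vf; apply: eq_bigr => i _; rewrite ffunE.
Qed.

Fact pr_is_linear j : linear (pr j).
Proof.
move=> c u v; apply: (pr_uniq (f := fun j => c *: pr j u + pr j v)) => [i|].
  by apply: W_linear; exact: pr_W.
by rewrite {1}[u]pr_sum {1}[v]pr_sum scaler_sumr -big_split.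
Qed.
HB.instance Definition _ j := GRing.isLinear.Build k V V *:%R (pr j) (pr_is_linear j).

Lemma pr_hom j i v : v \in W j -> pr i v = (i == j)%:R *: v.
Proof.
move=> Wv; apply: (pr_uniq (f := fun i => (i == j)%:R *: v)) => [l|].
  by case: eqP => [->|_]; rewrite ?scale1r // scale0r W_0.
rewrite (bigD1 j) //= eqxx scale1r big1 ?addr0 // => l /negPf->.
by rewrite scale0r.
Qed.

Lemma V_ext (X : lmodType k) (f f' : {linear V -> X}) :
  (forall j v, v \in W j -> f v = f' v) -> f =1 f'.
Proof.
move=> ff' v; rewrite [v]pr_sum !linear_sum; apply: eq_bigr => j _.
exact/ff'/pr_W.
Qed.

Lemma HV_ext (X : lmodType k) (f f' : {linear H ⊗ V -> X}) :
  (forall a i j v, (i < n)%N -> v \in W j -> f (ex a i ⊗ₜ v) = f' (ex a i ⊗ₜ v)) ->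
  f =1 f'.
Proof.
move=> ff'; apply: tens_ext => h v.
apply: (V_ext (f := f \o tensl h) (f' := f' \o tensl h)) => j w Ww /=.
apply: (H_ext (f := f \o tensr w) (f' := f' \o tensr w)) => a i iN /=.
exact: ff' iN Ww.
Qed.

Lemma VH_ext (X : lmodType k) (f f' : {linear V ⊗ H -> X}) :
  (forall a i j v, (i < n)%N -> v \in W j -> f (v ⊗ₜ ex a i) = f' (v ⊗ₜ ex a i)) ->
  f =1 f'.
Proof.
move=> ff'; apply: tens_ext => v h.
apply: (V_ext (f := f \o tensr h) (f' := f' \o tensr h)) => j w Ww /=.
apply: (H_ext (f := f \o tensl w) (f' := f' \o tensl w)) => a i iN /=.
exact: ff' iN Ww.
Qed.

Lemma HHV_ext (X : lmodType k) (f f' : {linear (H ⊗ H) ⊗ V -> X}) :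
  (forall a i b l j v, (i < n)%N -> (l < n)%N -> v \in W j ->
     f (ex a i ⊗ₜ ex b l ⊗ₜ v) = f' (ex a i ⊗ₜ ex b l ⊗ₜ v)) ->
  f =1 f'.
Proof.
move=> ff'; apply: tens_ext => u v.
apply: (V_ext (f := f \o tensl u) (f' := f' \o tensl u)) => j w Ww /=.
apply: (tens_ext (f := f \o tensr w) (g := f' \o tensr w)) => g h /=.
apply: (H_ext (f := f \o tensr w \o tensr h) (f' := f' \o tensr w \o tensr h)) => a i iN /=.
apply: (H_ext (f := f \o tensr w \o tensl (ex a i))
              (f' := f' \o tensr w \o tensl (ex a i))) => b l lN /=.
exact: ff' iN lN Ww.
Qed.

Lemma sum_linear (X Y : lmodType k) (I : finType) (F : I -> {linear X -> Y}) :
  linear (fun u => \sum_i F i u).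
Proof.
by move=> c u v; rewrite scaler_sumr -big_split; apply: eq_bigr => i _; rewrite linearP.
Qed.

(** A linear map with prescribed values on products of a basis vector of [H] and a homogeneous
    vector. The maps [e b l] stand for the coordinate maps to [V], so that the construction serves
    both [H ⊗ V] and [V ⊗ H]. *)
Lemma lift_sum (X Y : lmodType k) (F : gT -> nat -> gT * aut_type chi z -> {linear V -> X})
    (e : gT -> nat -> {linear Y -> V}) :
  exists f : {linear Y -> X}, forall a i j v y, (i < n)%N -> v \in W j ->
    (forall b l, e b l y = ((b == a) && (l == i))%:R *: v) -> f y = F a i j v.
Proof.
exists (lin (sum_linear (fun m : gT * 'I_n * (gT * aut_type chi z) =>
  F m.1.1 m.1.2 m.2 \o pr m.2 \o e m.1.1 m.1.2))) => a i j v y iN Wv ey.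
rewrite /= (bigD1 (a, Ordinal iN, j)) //= ey !eqxx scale1r (pr_hom _ Wv) eqxx scale1r.
rewrite big1 ?addr0 // => -[[b l] j'] /= ne; rewrite ey linearZ /= (pr_hom _ Wv).
have [bj|] := boolP ((b == a) && (l == i :> nat)); last by rewrite scale0r linear0.
have [jj'|_] := eqVneq j' j; last by rewrite scale0r scaler0 linear0.
move: bj ne => /andP[/eqP-> /eqP li]; rewrite jj' !xpair_eqE !eqxx andbT.
by rewrite -val_eqE /= li eqxx.
Qed.

Lemma HV_lift (X : lmodType k) (F : gT -> nat -> gT * aut_type chi z -> {linear V -> X}) :
  exists f : {linear H ⊗ V -> X}, forall a i j v, (i < n)%N -> v \in W j ->
    f (ex a i ⊗ₜ v) = F a i j v.
Proof.
have [f fE] := lift_sum F (fun b l => @teval_l k H V (cx b l)).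
exists f => a i j v iN Wv; apply: fE => // b l.
by rewrite /= teval_lE /= cx_ex.
Qed.

Lemma VH_lift (X : lmodType k) (F : gT -> nat -> gT * aut_type chi z -> {linear V -> X}) :
  exists f : {linear V ⊗ H -> X}, forall a i j v, (i < n)%N -> v \in W j ->
    f (v ⊗ₜ ex a i) = F a i j v.
Proof.
have [f fE] := lift_sum F (fun b l => @teval_r k H V (cx b l)).
exists f => a i j v iN Wv; apply: fE => // b l.
by rewrite /= teval_rE /= cx_ex.
Qed.

Lemma W_alpha i j v : v \in W j -> iter i alpha v \in W j.
Proof.
move=> Wv; elim: i => //= i Wi; apply/(cd_alpha_W dat).
by exists (iter i alpha v).
Qed.

Lemma W_U i g zeta v : v \in W (g, zeta) -> iter i U v \in W ((z ^- i * g)%g, zeta).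
Proof.
move=> Wv; elim: i => [|i IH]; first by rewrite expg0 invg1 mul1g.
have /= := cd_U_W dat IH; rewrite (commuteV (commute_sym (zC (z ^- i * g)%g))).
by rewrite expgSr invMg mulgA.
Qed.

Lemma aut_chi_zP (zeta : aut_type chi z) :
  [/\ {morph val zeta : a b / (a * b)%g}, val zeta z = z
    & forall a, chi (val zeta a) = chi a].
Proof.
have := valP zeta; rewrite inE => /and3P[zeta_aut /eqP zz /forallP chiz].
split=> // [a b|a]; last exact/eqP.
by have /morphicP := Aut_morphic zeta_aut; apply; rewrite inE.
Qed.

Lemma aut_M (zeta : aut_type chi z) a b :
  val zeta (a * b)%g = (val zeta a * val zeta b)%g.
Proof. by have [/(_ a b)] := aut_chi_zP zeta. Qed.

Lemma aut_zX (zeta : aut_type chi z) i : val zeta (z ^+ i)%g = (z ^+ i)%g.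
Proof.
have [_ zz _] := aut_chi_zP zeta.
elim: i => [|i IH]; last by rewrite expgS aut_M IH zz.
by apply: (mulgI (val zeta 1%g)); rewrite expg0 -aut_M !mulg1.
Qed.

(** * The axioms for maps given by the formulas on homogeneous vectors *)

Section Transposition.
Variable s : {linear H ⊗ V -> V ⊗ H}.
Hypothesis s_ex : forall a i j v, (i < n)%N -> v \in W j ->
  s (ex a i ⊗ₜ v) = iter i alpha v ⊗ₜ ex (val j.2 a) i.

(** Products of basis elements may have exponents beyond n, so the formula is wanted for all i. By
    x^n = λ(z^n - 1), either such elements vanish, or α^n is the identity and ζ fixes z^n, which
    makes both sides reduce alike. *)
Lemma s_ex_all a i j v : v \in W j ->
  s (ex a i ⊗ₜ v) = iter i alpha v ⊗ₜ ex (val j.2 a) i.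
Proof.
move=> Wv; elim/ltn_ind: i a => i IH a; have [iN|ni] := ltnP i n; first exact: s_ex.
have [lz|lz] := eqVneq (lam_zn z lam n) 0.
  by rewrite !ex_ge0 // tens0l tens0r linear0.
have ltin : (i - n < i)%N by rewrite ltn_subrL n_gt0 (leq_trans n_gt0 ni).
rewrite (ex_ge a ni) (ex_ge (val j.2 a) ni) tensZl tensDl tensZl.
rewrite (linearZZ s) (linearD s) (linearZZ s) !IH // aut_M aut_zX.
have -> : iter i alpha v = iter (i - n) alpha v.
  by rewrite -{1}(subnK ni) iterD (cd_alpha_n dat lz).
by rewrite tensZr tensDr tensZr.
Qed.

Lemma s_left_space : is_left_space s.
Proof.
have [alphaV alphaK alphaVK] := cd_alpha_bij dat.
have alphaV_lin : linear alphaV.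
  by move=> c u v; apply: (can_inj alphaK); rewrite linearP /= !alphaVK.
have W_alphaV i j v : v \in W j -> iter i alphaV v \in W j.
  move=> Wv; elim: i => //= i /(cd_alpha_W dat)[w Ww ->].
  by rewrite alphaK.
have iterK i v : iter i alpha (iter i alphaV v) = v.
  by elim: i v => //= i IH v; rewrite -iterS iterSr /= alphaVK IH.
have iterVK i v : iter i alphaV (iter i alpha v) = v.
  by elim: i v => //= i IH v; rewrite -iterS iterSr /= alphaK IH.
split.
(* The inverse is built on homogeneous vectors from ζ^-1 and α^-i; it is correct because α^-1
   preserves the degrees too. *)
- have [f fE] := VH_lift (fun a i j => tensl (ex ((val j.2)^-1 a)%g i)
      \o lin (iter_is_linear (lin alphaV_lin) i)).
  exists f => u.
    apply: (HV_ext (f := f \o s) (f' := idfun)) => a i j v iN Wv /=.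
    by rewrite (s_ex_all a i Wv) (fE _ _ j) ?W_alpha //= permK iterVK.
  apply: (VH_ext (f := s \o f) (f' := idfun)) => a i j v iN Wv /=.
  by rewrite (fE _ _ j) //= /tensl (s_ex_all _ _ (W_alphaV i j v Wv)) permKV iterK.
- move=> v; apply: (V_ext (f := s \o tensl 1) (f' := tensr 1)) => j w Ww /=.
  have := s_ex_all 1%g 0 Ww; rewrite (aut_zX _ 0) ex1.
  exact.
- move=> u; apply: (HHV_ext (f := s \o tmap mu idfun)
    (f' := tmap idfun mu \o pass_l s \o @tassoc k H H V)) => a i b l j v iN lN Wv /=.
  rewrite tmapE /= muE tassocE.
  rewrite (pass_l_tens (s_ex_all b l Wv) (s_ex_all a i (W_alpha l Wv))).
  rewrite tmapE /= muE !exM tensZl tensZr linearZ /= (s_ex_all _ _ Wv) iterD aut_M.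
  by have [_ _ ->] := aut_chi_zP j.2.
- move=> u; apply: (HV_ext (f := teval_r eps \o s) (f' := teval_l eps)) => a i j v iN Wv /=.
  rewrite (s_ex_all a i Wv) teval_rE teval_lE /= !eps_ex.
  by case: i {iN} => //= i; rewrite !scale0r.
- move=> u; apply: (HV_ext (f := tmap idfun Delta \o s)
    (f' := pass_l s \o @tassoc k H H V \o tmap Delta idfun)) => a i j v iN Wv /=.
  rewrite (s_ex_all a i Wv) !tmapE /= !Delta_ex // tens_sumr tens_suml.
  rewrite (linear_sum (@tassoc k H H V)) (linear_sum (pass_l s)); apply: eq_bigr => l _.
  rewrite tensZr tensZl (linearZZ (@tassoc k H H V)) (linearZZ (pass_l s)) /= tassocE.
  rewrite (pass_l_tens (s_ex_all _ _ Wv) (s_ex_all _ _ (W_alpha _ Wv))) aut_M aut_zX.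
  by rewrite -iterD subnKC // -ltnS.
- move=> u; apply: (HHV_ext (f := pass_l s \o @tassoc k H H V \o tmap braid idfun)
    (f' := tmap idfun braid \o pass_l s \o @tassoc k H H V)) => a i b l j v iN lN Wv /=.
  rewrite tmapE braid_ex // tensZl (linearZZ (@tassoc k H H V)) (linearZZ (pass_l s)).
  rewrite /= !tassocE !(pass_l_tens (s_ex_all _ _ Wv) (s_ex_all _ _ (W_alpha _ Wv))).
  by rewrite tmapE /= braid_ex // tensZr -!iterD addnC.
Qed.

Lemma s_transposition : is_transposition_of n W iota x alpha s.
Proof.
move=> a i zeta v [f Wf ->]; rewrite tens_sumr linear_sum (iter_sum alpha) tens_suml.
by apply: eq_bigr => g _; exact: s_ex (Wf g).
Qed.

Variable nu : {linear V -> V ⊗ H}.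
Hypothesis nu_hom : forall g zeta v, v \in W (g, zeta) ->
  nu v = \sum_(l < n) (qfact t l)^-1 *: (iter l U v ⊗ₜ ex (z ^- l * g)%g l).

Lemma nu_coaction : is_coaction_of q n W iota x U nu.
Proof.
move=> g v [f Wf ->]; rewrite linear_sum.
rewrite (eq_bigr _ (fun zeta _ => nu_hom (Wf zeta))) exchange_big; apply: eq_bigr => l _ /=.
by rewrite (iter_sum U) tens_suml scaler_sumr.
Qed.

Lemma teval_nu a i g zeta v : (i < n)%N -> v \in W (g, zeta) ->
  teval_r (cx a i) (nu v) = ((a == z ^- i * g)%g%:R * (qfact t i)^-1) *: iter i U v.
Proof.
move=> iN Wv; rewrite (nu_hom Wv) linear_sum (bigD1 (Ordinal iN)) //= big1 ?addr0.
  by rewrite linearZ /= teval_rE /= cx_ex // eqxx andbT scalerA mulrC.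
move=> l li; rewrite linearZ /= teval_rE /= cx_ex //.
have -> : (i == l :> nat) = false.
  by apply: contraNF li => /eqP il; apply/eqP/val_inj.
by rewrite andbF scale0r scaler0.
Qed.

Lemma iter_U_alpha l i v :
  iter l U (iter i alpha v) = q ^+ (i * l) *: iter i alpha (iter l U v).
Proof.
have U1 w : U (iter i alpha w) = q ^+ i *: iter i alpha (U w).
  elim: i => [|j IH] /=; first by rewrite scale1r.
  by rewrite (cd_U_alpha dat) IH linearZ /= scalerA exprS.
elim: l => [|l IH] /=; first by rewrite muln0 scale1r.
by rewrite IH linearZ /= U1 scalerA mulnS addnC exprD.
Qed.

Lemma s_nu_comodule : is_right_comodule s nu.
Proof.
split; first exact: s_left_space.
- move=> v; apply: (V_ext (f := @tassoc k V H H \o tmap nu idfun \o nu)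
    (f' := tmap idfun Delta \o nu)) => -[g zeta] w Ww /=.
  apply: teval_tform_inj => a i b j iN jN.
  rewrite teval_r_tassoc teval_Delta (teval_nu _ jN Ww) !linearZ /=.
  rewrite (teval_nu _ iN (W_U j Ww)) !scalerA -iterD.
  (* Beyond n both sides vanish, the left one by U^n = 0 and the right one because [H] has no
     coordinate there. *)
  have [ijN|nij] := ltnP (i + j) n; last first.
    rewrite cx_tens_ge // -(subnK nij) iterD (cd_U_n dat).
    have -> : iter (i + j - n) U 0 = 0 by elim: (i + j - n)%N => //= m ->; exact: linear0.
    by rewrite !scaler0.
  rewrite (teval_nu _ ijN Ww) scalerA.
  have -> : (qfact t i)^-1 = qbin t (i + j) i * (qfact t (i + j))^-1 * qfact t j.
    have := qbin_fact t (leq_addr j i); rewrite addKn => <-.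
    by field; rewrite !qfact_neq0 // qbin_neq0 // leq_addr.
  have -> : (z ^- i * (z ^- j * g) = z ^- (i + j) * g)%g.
    by rewrite mulgA -invMg -expgD addnC.
  have [->|_] := eqVneq a (z ^- (i + j) * g)%g; last by rewrite !(mul0r, mulr0).
  have -> : (z ^- (i + j) * g * z ^+ i = z ^- j * g)%g.
    rewrite -mulgA -(commuteX2 i 1 (zC g)) expg1 mulgA; congr (_ * g)%g.
    by rewrite expgD invMg mulgKV.
  by congr (_ *: _); field; rewrite !qfact_neq0.
- move=> v; apply: (V_ext (f := teval_r eps \o nu) (f' := idfun)) => -[g zeta] w Ww /=.
  rewrite teval_r_eps (bigD1 g) //= (teval_nu _ n_gt0 Ww) big1 ?addr0.
    by rewrite expg0 invg1 mul1g eqxx qfact0 invr1 mulr1 scale1r.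
  move=> a /negPf ag; rewrite (teval_nu _ n_gt0 Ww) expg0 invg1 mul1g ag mul0r scale0r.
  by [].
- move=> u; apply: (HV_ext (f := @tassoc k V H H \o tmap nu idfun \o s)
    (f' := tmap idfun braid \o @tassoc k V H H \o tmap s idfun \o @tassocV k H V H
      \o tmap idfun nu)) => a i [g zeta] v iN Wv /=.
  rewrite (s_ex_all a i Wv) !tmapE /= (nu_hom (W_alpha i Wv)) (nu_hom Wv).
  rewrite tens_suml tens_sumr.
  pose F : {linear H ⊗ (V ⊗ H) -> V ⊗ (H ⊗ H)} := tmap idfun braid \o @tassoc k V H H
    \o tmap s idfun \o @tassocV k H V H.
  rewrite -[RHS]/(F _) (linear_sum F) (linear_sum (@tassoc k V H H)); apply: eq_bigr => l _.
  rewrite tensZl tensZr (linearZZ F) (linearZZ (@tassoc k V H H)); congr (_ *: _).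
  rewrite /F /= tassocE tassocVE tmapE /= (s_ex_all a i (W_U l Wv)) tassocE tmapE /=.
  (* The power of q from the braid matches the one from U α = q α U. *)
  by rewrite braid_ex // tensZr iter_U_alpha tensZl.
Qed.

End Transposition.

Lemma comodule_of_datum :
  exists (s : {linear H ⊗ V -> V ⊗ H}) (nu : {linear V -> V ⊗ H}),
    [/\ is_right_comodule s nu,
        is_transposition_of n W iota x alpha s,
        is_coaction_of q n W iota x U nu
      & forall (s' : {linear H ⊗ V -> V ⊗ H}) (nu' : {linear V -> V ⊗ H}),
          is_transposition_of n W iota x alpha s' ->
          is_coaction_of q n W iota x U nu' ->
          s' =1 s /\ nu' =1 nu].
Proof.
have [s s_ex] := HV_lift (fun a i j => tensr (ex (val j.2 a) i)
  \o lin (iter_is_linear alpha i)).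
pose nu := lin (sum_linear (fun m : gT * aut_type chi z * 'I_n =>
  (qfact t m.2)^-1 \*: (tensr (ex (z ^- m.2 * m.1.1)%g m.2)
    \o lin (iter_is_linear U m.2) \o pr m.1))).
have nu_hom g zeta v : v \in W (g, zeta) ->
    nu v = \sum_(l < n) (qfact t l)^-1 *: (iter l U v ⊗ₜ ex (z ^- l * g)%g l).
  move=> Wv; rewrite /nu /= -(pair_bigA _ (fun j (l : 'I_n) =>
    (qfact t l)^-1 *: tensr (ex (z ^- l * j.1)%g l) (iter l U (pr j v)))) /=.
  rewrite (bigD1 (g, zeta)) //= (pr_hom _ Wv) eqxx scale1r.
  rewrite [X in _ + X]big1 ?addr0 // => j /negPf jg; rewrite big1 // => l _.
  rewrite (pr_hom _ Wv) jg scale0r.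
  have -> : iter l U 0 = 0 by elim: (val l) => //= m ->; exact: linear0.
  by rewrite linear0 scaler0.
have s_tr := s_transposition s_ex; have nu_co := nu_coaction nu_hom.
exists s, nu; split=> //; first exact: s_nu_comodule.
move=> s' nu' s'_tr nu'_co; split.
  apply: HV_ext => a i [g zeta] v iN Wv.
  have Vv : in_V_aut W zeta v.
    (* A homogeneous vector lies in V_ζ through the family concentrated in its own degree. *)
    exists (fun h => if h == g then v else 0).
      by move=> h; case: eqP => [->|_]; rewrite ?W_0.
    by rewrite -big_mkcond big_pred1_eq.
  exact: etrans (s'_tr a (Ordinal iN) _ _ Vv) (esym (s_tr a (Ordinal iN) _ _ Vv)).
apply: V_ext => -[g zeta] v Wv.
have Vv : in_V_grp W g v.
  exists (fun xi => if xi == zeta then v else 0).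
    by move=> xi; case: eqP => [->|_]; rewrite ?W_0.
  by rewrite -big_mkcond big_pred1_eq.
by rewrite (nu'_co _ _ Vv) (nu_co _ _ Vv).
Qed.

End Construction.
(** * The datum of a comodule *)

Section Classification.
Hypothesis hpq : (chi z, q) <> (1, -1).
Variables (V : lmodType k) (s : {linear H ⊗ V -> V ⊗ H}) (nu : {linear V -> V ⊗ H}).
Hypothesis sV : is_left_space s.

(** * Coefficient operators of a transposition, and the relations between them *)

Definition scoef (h : H) g i (v : V) : V := teval_r (cx g i) (s (h ⊗ₜ v)).
HB.instance Definition _ h g i :=
  GRing.Linear.copy (scoef h g i) (teval_r (cx g i) \o s \o tensl h).

Definition ncoef g i (v : V) : V := teval_r (cx g i) (nu v).
HB.instance Definition _ g i := GRing.Linear.copy (ncoef g i) (teval_r (cx g i) \o nu).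

Lemma scoef_ge h g i v : (n <= i)%N -> scoef h g i v = 0.
Proof. exact: cx_tens_ge. Qed.

Lemma s_sum h v : s (h ⊗ₜ v) = \sum_g \sum_(i < n) scoef h g i v ⊗ₜ ex g i.
Proof. exact: cx_tens_sum. Qed.

Lemma teval_pass g i g' i' h h' v :
  teval_r (tform (cx g i) (cx g' i')) (pass_l s (h ⊗ₜ (h' ⊗ₜ v))) =
  scoef h g i (scoef h' g' i' v).
Proof. by rewrite /pass_l /= tmapE; exact: teval_r_pass. Qed.

Lemma scoef_Delta h g i g' i' v :
  teval_r (tform (cx g i) (cx g' i')) (pass_l s (tassoc (Delta h ⊗ₜ v))) =
  ((g' == g * z ^+ i)%g%:R * qbin t (i + i') i) *: scoef h g (i + i') v.
Proof. by rewrite -teval_Delta (ls_Delta sV) tmapE. Qed.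

(** As a is group-like, v ↦ s(a ⊗ v) is coassociative; this is that law in coordinates. *)
Lemma scoef_group a g i g' i' v : scoef (iota a) g i (scoef (iota a) g' i' v) =
  ((g' == g * z ^+ i)%g%:R * qbin t (i + i') i) *: scoef (iota a) g (i + i') v.
Proof. by rewrite -scoef_Delta (hd_Delta_g hH) tassocE teval_pass. Qed.

Lemma scoef_1 g i v : scoef 1 g i v = ((g == 1%g) && (i == 0))%:R *: v.
Proof. by rewrite /scoef (ls_1 sV) teval_rE /= -ex1 cx_ex ?n_gt0. Qed.

(** Compatibility with Δ(x) = 1 ⊗ x + x ⊗ z in coordinates; the two terms on the right come from its
    two summands. *)
Lemma scoef_x g i g' i' v :
  ((g' == g * z ^+ i)%g%:R * qbin t (i + i') i) *: scoef x g (i + i') v =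
  ((g == 1%g) && (i == 0))%:R *: scoef x g' i' v + scoef x g i (scoef (iota z) g' i' v).
Proof.
rewrite -scoef_Delta (hd_Delta_x hH) tensDl (linearD (@tassoc k H H V)) (linearD (pass_l s)).
rewrite linearD /= !tassocE; by rewrite !teval_pass scoef_1.
Qed.

Lemma scoef_braid a i b j g k1 g' k2 v : (i < n)%N -> (j < n)%N ->
  q ^+ (i * j) *: scoef (ex b j) g k1 (scoef (ex a i) g' k2 v) =
  q ^+ (k1 * k2) *: scoef (ex a i) g' k2 (scoef (ex b j) g k1 v).
Proof.
move=> iN jN.
have := ls_braid sV (ex a i ⊗ₜ ex b j ⊗ₜ v).
move/(congr1 (teval_r (tform (cx g k1) (cx g' k2)))).
rewrite teval_braid tassocE teval_pass tmapE braid_ex // tensZl.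
rewrite (linearZZ (@tassoc k H H V)) (linearZZ (pass_l s)) linearZ /=.
by rewrite tassocE teval_pass.
Qed.

(** With both exponents of the group-like factor equal to 0, the powers of q in [scoef_braid]
    disappear. *)
Lemma scoef_iota_comm a b c j g i v : (j < n)%N ->
  scoef (iota a) b 0 (scoef (ex c j) g i v) = scoef (ex c j) g i (scoef (iota a) b 0 v).
Proof.
move=> jN; have := scoef_braid c a b 0 g i v jN n_gt0.
by rewrite muln0 mul0n !expr0 !scale1r exE.
Qed.

Lemma scoef_xx g i g' i' v :
  q *: scoef x g i (scoef x g' i' v) = q ^+ (i * i') *: scoef x g' i' (scoef x g i v).
Proof. by have := scoef_braid 1 1 g i g' i' v n_gt1 n_gt1; rewrite exx mul1n expr1. Qed.

Lemma s_ex_inj g i v : (i < n)%N -> s (ex g i ⊗ₜ v) = 0 -> v = 0.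
Proof.
move=> iN sv.
have : ex g i ⊗ₜ v = 0 by apply: (bij_inj (ls_bij sV)); rewrite sv linear0.
move/(congr1 (teval_l (cx g i))); rewrite teval_lE /= cx_ex // !eqxx scale1r => ->.
by rewrite linear0.
Qed.

Lemma scoef_sum h v : \sum_g scoef h g 0 v = (eps h : k) *: v.
Proof. by rewrite -teval_r_eps (ls_eps sV) teval_lE. Qed.

Lemma scoef_iota_idem a g g' i v :
  scoef (iota a) g 0 (scoef (iota a) g' i v) = (g' == g)%:R *: scoef (iota a) g i v.
Proof. by rewrite scoef_group expg0 mulg1 add0n qbin0 mulr1. Qed.

(** For p = 1 the element q itself has order n > 1, and q = -1 is excluded by [hpq]. *)
Lemma q_neq1 : chi z = 1 -> q != 1 /\ q ^+ 2 != 1.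
Proof.
case: hD => _ _ _ /andP[_ tn] _ pz; rewrite pz mulr1 in tn.
have q1 : q != 1.
  apply/eqP => q1; have := prim_order_dvd tn 1.
  by rewrite q1 expr1n eqxx => /dvdn_leq => /(_ isT); rewrite leqNgt n_gt1.
split=> //; rewrite sqrf_eq1 negb_or q1 /=.
by apply/eqP => q1'; apply: hpq; rewrite pz q1'.
Qed.

(** When s(z ⊗ -) has only exponent 0, the last term of [scoef_x] drops out. Splitting an exponent
    above 1 as 1 plus the rest leaves a nonzero binomial times the wanted coefficient; exponent 1 is
    split as 0 + 1. *)
Lemma scoef_x_high : (forall g i v, (0 < i)%N -> scoef (iota z) g i v = 0) ->
  forall g i v, (0 < i)%N -> (g, i) != (1%g, 1) -> scoef x g i v = 0.
Proof.
move=> Tz g [//|[|i]] v _ gi.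
  have := scoef_x g 0 g 1 v; rewrite expg0 mulg1 eqxx qbin0 mulr1 scale1r => ->.
  rewrite Tz // linear0 addr0 andbT.
  have -> : (g == 1%g) = false by apply: contraNF gi => /eqP->.
  by rewrite scale0r.
have [ni|iN] := leqP n i.+2; first exact: scoef_ge.
have := scoef_x g 1 (g * z)%g i.+1 v; rewrite expg1 eqxx mul1r andbF scale0r add0r.
rewrite Tz // linear0 => /eqP; rewrite scaler_eq0 (negPf (qbin_neq0 _)) ?add1n //.
by move/eqP.
Qed.

(** Write P for the coefficient at (g, 0) and D for the one at (g, 1). If z <> 1, then D = P D = D
    P, and D P = 0 because D is supported on the component of gz, not of g. If z = 1, then α D = q^2
    α D, with q^2 <> 1. *)
Lemma scoef_iota1 a g v : scoef (iota a) g 1 v = 0.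
Proof.
have [z1|z1] := eqVneq z 1%g; last first.
  have := scoef_iota_idem a g g 1 v; rewrite eqxx scale1r => <-.
  rewrite -(exE a) {1}exE scoef_iota_comm ?n_gt0 // exE scoef_group expg1.
  have -> : (g == g * z)%g = false.
    by apply: contraNF z1 => /eqP gz; apply/eqP/(mulgI g); rewrite mulg1.
  by rewrite mul0r scale0r.
have Tz g' i v' : scoef (iota z) g' i v' = ((g' == 1%g) && (i == 0))%:R *: v'.
  by rewrite z1 (hd_1 hH) scoef_1.
have Tz0 g' i v' : (0 < i)%N -> scoef (iota z) g' i v' = 0.
  by case: i => // i _; rewrite Tz andbF scale0r.
(* For z = 1, compatibility with Δ(x) in exponent 0 reads X = X + X at g' = 1, and X = 0
   elsewhere. *)
have X0 g' v' : scoef x g' 0 v' = 0.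
  have := scoef_x g' 0 g' 0 v'; rewrite expg0 mulg1 eqxx qbin0 mulr1 scale1r Tz andbT.
  have [->|_] := eqVneq g' 1%g; last by rewrite !scale0r linear0 addr0.
  by rewrite !scale1r => /eqP; rewrite -subr_eq0 opprD addrA subrr add0r oppr_eq0 => /eqP.
have sx v' : s (ex 1 1 ⊗ₜ v') = scoef x 1 1 v' ⊗ₜ x.
  rewrite exx; apply: teval_cx_inj => g' i iN.
  rewrite -/(scoef x g' i v') teval_rE /= -[in RHS]exx.
  rewrite cx_ex ?n_gt1 //.
  have [/eqP[-> ->]|gi] := boolP ((g', i) == (1%g, 1)); first by rewrite !eqxx exx scale1r.
  move: (gi); rewrite xpair_eqE => /negPf->; rewrite scale0r.
  by case: (posnP i) gi => [->|i0] gi; [exact: X0 | exact: scoef_x_high].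
apply: (@s_ex_inj 1 1 _ n_gt1); rewrite sx.
suff -> : scoef x 1 1 (scoef (iota a) g 1 v) = 0 by rewrite tens0l.
have [_ q2] := q_neq1 (etrans (congr1 chi z1) chi1).
(* The braid relation in both orders: α D = q D α and D α = q α D. *)
have := scoef_braid a 1 1 1 g 1 v n_gt0 n_gt1.
have := scoef_braid 1 a g 1 1 1 v n_gt1 n_gt0.
rewrite exx exE mul0n !muln1 expr0 !scale1r !expr1 => -> /eqP.
rewrite scalerA -expr2 -subr_eq0 -{1}[scoef x _ _ _]scale1r -scalerBl scaler_eq0 subr_eq0.
by rewrite eq_sym (negPf q2) => /eqP.
Qed.

(** Up to the nonzero number (i)_t, the coefficient of exponent i factors through one of exponent
    1. *)
Lemma scoef_iota_high a g i v : (0 < i)%N -> scoef (iota a) g i v = 0.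
Proof.
case: i => // i _; have [ni|iN] := leqP n i.+1; first exact: scoef_ge.
have := scoef_group a g 1 (g * z)%g i v; rewrite expg1 eqxx mul1r scoef_iota1.
move/esym/eqP; rewrite scaler_eq0 (negPf (qbin_neq0 _)) ?add1n //.
by move/eqP.
Qed.

(** * Eigenvectors of the group elements, and the value of s on x *)

Definition eigen (a b : gT) (w : V) : Prop := s (iota a ⊗ₜ w) = w ⊗ₜ iota b.

Lemma s_iota a v : s (iota a ⊗ₜ v) = \sum_b scoef (iota a) b 0 v ⊗ₜ iota b.
Proof.
rewrite s_sum; apply: eq_bigr => b _.
rewrite (bigD1 (Ordinal n_gt0)) //= exE big1 ?addr0 // => i i0.
rewrite scoef_iota_high ?tens0l // lt0n; apply: contraNN i0 => /eqP i0.
by apply/eqP/val_inj.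
Qed.

Lemma eigen_scoef a b w c : eigen a b w -> scoef (iota a) c 0 w = (c == b)%:R *: w.
Proof. by rewrite /eigen /scoef => ->; rewrite teval_rE /= -(exE b) cx_ex ?n_gt0 // andbT. Qed.

Lemma scoef_eigen a b w : scoef (iota a) b 0 w = w -> eigen a b w.
Proof.
move=> Pw; rewrite /eigen s_iota (bigD1 b) //= Pw big1 ?addr0 // => c cb.
by rewrite -Pw scoef_iota_idem eq_sym (negPf cb) scale0r tens0l.
Qed.

Lemma eigen_proj a b v : eigen a b (scoef (iota a) b 0 v).
Proof. by apply: scoef_eigen; rewrite scoef_iota_idem eqxx scale1r. Qed.

Lemma scoef_iota_sum a v : v = \sum_b scoef (iota a) b 0 v.
Proof. by rewrite scoef_sum (hd_eps_g hH) scale1r. Qed.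

Lemma eigen_comm a b w c j g i : (j < n)%N -> eigen a b w -> eigen a b (scoef (ex c j) g i w).
Proof.
by move=> jN Ew; apply: scoef_eigen; rewrite scoef_iota_comm // (eigen_scoef _ Ew) eqxx scale1r.
Qed.

Lemma s_mul_eigen h a b w : eigen a b w ->
  s ((h * iota a) ⊗ₜ w) = tmap idfun (rmul (iota b)) (s (h ⊗ₜ w)).
Proof.
move=> Ew; have := ls_mu sV (h ⊗ₜ iota a ⊗ₜ w).
rewrite tmapE /= muE => ->; rewrite tassocE /pass_l /= tmapE /= Ew tassocVE tmapE /=.
elim/tens_ind: (s _) => [|v c|u u' IH IH'].
- by rewrite tens0l !linear0.
- by rewrite tassocE !tmapE /= muE.
- by rewrite tensDl !linearD /= IH IH'.
Qed.

(** Here a acts after h, so the eigenvector condition is needed on the coefficients of s(h ⊗ w)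
    rather than on w. *)
Lemma s_eigen_mul h a b w : (forall g i, (i < n)%N -> eigen a b (scoef h g i w)) ->
  s ((iota a * h) ⊗ₜ w) = tmap idfun (lmul (iota b)) (s (h ⊗ₜ w)).
Proof.
move=> Ew; have := ls_mu sV (iota a ⊗ₜ h ⊗ₜ w).
rewrite tmapE /= muE => ->; rewrite tassocE /pass_l /= tmapE /= s_sum.
pose F : {linear V ⊗ H -> V ⊗ H} :=
  tmap idfun mu \o @tassoc k V H H \o tmap s idfun \o @tassocV k H V H \o tensl (iota a).
pose G : {linear V ⊗ H -> V ⊗ H} := tmap idfun (lmul (iota b)).
rewrite -[LHS]/(F _) -[RHS]/(G _) (linear_sum F) (linear_sum G); apply: eq_bigr => g _.
rewrite (linear_sum F) (linear_sum G); apply: eq_bigr => i _.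
by rewrite /F /G /= tmapE /tensl tassocVE tmapE /= Ew // tassocE tmapE /= muE.
Qed.

(** Both sides compute the coefficient of b x^i in s(xa ⊗ w), the right one through x a = χ(a) a
    x. *)
Lemma eigen_x a b w i : eigen a b w -> (i < n)%N ->
  chi b ^+ i *: scoef x 1 i w = chi a *: scoef x 1 i w.
Proof.
move=> Ew iN; rewrite -teval_cx_rmul -(s_mul_eigen x Ew) (hd_xg hH).
rewrite tensZl !linearZ /= (s_eigen_mul (b := b)) ?teval_cx_lmul // => g j jN.
by rewrite -exx; apply: eigen_comm n_gt1 Ew.
Qed.

(** This operator is β. If χ(a) <> 1 for some a, the relation β = χ(a) β on eigenvectors of a kills
    it. If χ = 1, then p = 1, and the q-commutation of β with itself and with α yields β β = α β =
    0, so that s(x ⊗ β(v)) = 0. *)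
Lemma scoef_x10 v : scoef x 1 0 v = 0.
Proof.
have [/forallP chi1|] := boolP [forall a, chi a == 1]; last first.
  rewrite negb_forall => /existsP[a nchi]; rewrite [v](scoef_iota_sum a) linear_sum.
  rewrite big1 // => b _; have /eqP := eigen_x (eigen_proj a b v) n_gt0.
  by rewrite expr0 scale1r -subr_eq0 -{1}[scoef x _ _ _]scale1r -scalerBl scaler_eq0 subr_eq0
             eq_sym (negPf nchi) => /eqP.
have [q1 q2] := q_neq1 (eqP (chi1 z)).
have bb w : scoef x 1 0 (scoef x 1 0 w) = 0.
  have /eqP := scoef_xx 1 0 1 0 w.
  by rewrite expr0 scale1r -subr_eq0 -{2}[scoef x _ _ _]scale1r -scalerBl scaler_eq0 subr_eq0
     (negPf q1) => /eqP.
have ab w : scoef x 1 1 (scoef x 1 0 w) = 0.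
  have /eqP := scoef_xx 1 1 1 0 w; have := scoef_xx 1 0 1 1 w.
  rewrite !expr0 !scale1r => <-.
  rewrite scalerA -expr2 -subr_eq0 -{2}[scoef x _ _ _]scale1r -scalerBl scaler_eq0 subr_eq0.
  by rewrite (negPf q2) => /eqP ->; rewrite scaler0.
have xhigh := scoef_x_high (fun g i w => @scoef_iota_high z g i w).
apply: (@s_ex_inj 1 1 _ n_gt1); rewrite exx s_sum.
rewrite big1 // => g _; rewrite big1 // => i _.
have [/eqP[-> ->]|gi] := boolP ((g, val i) == (1%g, 1)); first by rewrite ab tens0l.
have [i0|i0] := posnP i; last by rewrite xhigh ?tens0l.
rewrite {gi}i0; have [->|/negPf g1] := eqVneq g 1%g; first by rewrite bb tens0l.
(* For g <> 1 the coefficient at (g, 0) is -β P β with P a coefficient of s(z ⊗ -); P commutes with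
   β, and β β = 0. *)
have := scoef_x 1 0 g 0 (scoef x 1 0 v); rewrite mul1g expg0 g1 mul0r scale0r eqxx scale1r.
have -> : scoef (iota z) g 0 (scoef x 1 0 v) = scoef x 1 0 (scoef (iota z) g 0 v).
  by rewrite -exx scoef_iota_comm ?n_gt1.
by rewrite bb addr0 => <-; rewrite tens0l.
Qed.

Lemma s_x v : s (x ⊗ₜ v) = scoef x 1 1 v ⊗ₜ x.
Proof.
have xhigh := scoef_x_high (fun g i w => @scoef_iota_high z g i w).
apply: teval_cx_inj => g i iN; rewrite -/(scoef x g i v) teval_rE /= -[in RHS]exx.
rewrite cx_ex ?n_gt1 // exx.
have [/eqP[-> ->]|gi] := boolP ((g, i) == (1%g, 1)); first by rewrite !eqxx scale1r.
move: (gi); rewrite xpair_eqE => /negPf->; rewrite scale0r.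
have [i0|i0] := posnP i; last exact: xhigh.
rewrite {gi iN}i0; have [->|/negPf g1] := eqVneq g 1%g; first exact: scoef_x10.
have := scoef_x 1 0 g 0 v; rewrite mul1g expg0 g1 mul0r scale0r eqxx scale1r.
by rewrite scoef_x10 addr0 => <-.
Qed.

(** * The automorphism α, and the constraints on eigenvectors *)

Definition comod_alpha v := scoef x 1 1 v.
HB.instance Definition _ := GRing.Linear.copy comod_alpha (scoef x 1 1).

Lemma comod_alpha_inj0 v : comod_alpha v = 0 -> v = 0.
Proof.
by move=> av; apply: (@s_ex_inj 1 1 _ n_gt1); rewrite exx s_x -/(comod_alpha v) av tens0l.
Qed.

Lemma eigen_alpha a b w : eigen a b w -> eigen a b (comod_alpha w).
Proof. by rewrite /comod_alpha -exx; apply: eigen_comm n_gt1. Qed.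

(** The coefficient of x ⊗ g in the compatibility with Δ(x) says that α kills the g-component of w
    under s(z ⊗ -) for g <> z, and α is injective. *)
Lemma eigen_z w : eigen z z w.
Proof.
apply: scoef_eigen; rewrite [RHS](scoef_iota_sum z) (bigD1 z) //= big1 ?addr0 // => g gz.
apply: comod_alpha_inj0; have := scoef_x 1 1 g 0 w.
by rewrite mul1g expg1 (negPf gz) mul0r andbF !scale0r add0r => /esym.
Qed.

Lemma eigen_chi a b w : eigen a b w -> w != 0 -> chi b = chi a.
Proof.
move=> Ew; apply: contraNeq => nab; apply/eqP/comod_alpha_inj0/eqP.
have /eqP := eigen_x Ew n_gt1; rewrite expr1 -subr_eq0 -scalerBl scaler_eq0 subr_eq0.
by rewrite (negPf nab).
Qed.

Lemma eigen1 w : eigen 1 1 w.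
Proof. by rewrite /eigen (hd_1 hH) (ls_1 sV). Qed.

Lemma eigenM a b c d w : eigen a b w -> eigen c d w -> eigen (a * c) (b * d) w.
Proof.
move=> Eab Ecd; rewrite /eigen (hd_mul hH) (s_mul_eigen _ Ecd) Eab tmapE.
by rewrite /= /rmul (hd_mul hH).
Qed.

Lemma s_xn i v : s (x ^+ i ⊗ₜ v) = iter i comod_alpha v ⊗ₜ x ^+ i.
Proof.
elim: i => [|i IH]; first exact: (ls_1 sV).
have := ls_mu sV (x ⊗ₜ x ^+ i ⊗ₜ v).
rewrite tmapE /= muE exprS => ->.
by rewrite tassocE /pass_l /= tmapE /= IH tassocVE tmapE /= s_x tassocE tmapE /= muE.
Qed.

Lemma s_ex_eigen a b i v : eigen a b v ->
  s (ex a i ⊗ₜ v) = iter i comod_alpha v ⊗ₜ ex b i.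
Proof.
move=> Ev; rewrite /ex; have := ls_mu sV (iota a ⊗ₜ x ^+ i ⊗ₜ v).
rewrite tmapE /= muE => ->.
rewrite tassocE /pass_l /= tmapE /= s_xn tassocVE tmapE /=.
have -> : eigen a b (iter i comod_alpha v) by elim: i => //= i; apply: eigen_alpha.
by rewrite tassocE tmapE /= muE.
Qed.

Lemma scoef_ex g i v : (i < n)%N ->
  scoef (ex g i) 1 1 v = (i == 1)%:R *: comod_alpha (scoef (iota g) 1 0 v).
Proof.
move=> iN; rewrite {1}[v](scoef_iota_sum g) linear_sum (bigD1 1%g) //= big1 ?addr0.
  rewrite /scoef (s_ex_eigen i (eigen_proj g 1 v)) teval_rE /= cx_ex // eqxx eq_sym /=.
  by case: eqP => [->|_]; rewrite ?scale0r.
move=> b b1; rewrite /scoef (s_ex_eigen i (eigen_proj g b v)) teval_rE /= cx_ex //.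
by rewrite eq_sym (negPf b1) scale0r.
Qed.

(** The tensor w ⊗ x is a value of s, and by [scoef_ex] its coefficient at x is a sum of values of
    α. *)
Lemma comod_alpha_surj w : exists v, w = comod_alpha v.
Proof.
have [f _ fK] := ls_bij sV.
have : teval_r (cx 1 1) (s (f (w ⊗ₜ x))) = w.
  by rewrite fK teval_rE /= -exx cx_ex ?n_gt1 // !eqxx scale1r.
move=> {1}<-; elim/tens_ind: (f _) => [|h v|u u' [v IH] [v' IH']].
- by exists 0; rewrite !linear0.
- pose F : {linear H -> V} := teval_r (cx 1 1) \o s \o tensr v.
  exists (\sum_g \sum_(i < n) (cx g i h * (i == 1 :> nat)%:R) *: scoef (iota g) 1 0 v).
  rewrite -[LHS]/(F h) {1}[h]cx_sum (linear_sum F) linear_sum; apply: eq_bigr => g _.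
  rewrite (linear_sum F) linear_sum; apply: eq_bigr => i _.
  rewrite (linearZZ F) (linearZZ comod_alpha) -[F _]/(scoef (ex g i) 1 1 v).
  by rewrite scoef_ex // scalerA.
- by exists (v + v'); rewrite !linearD /= IH IH'.
Qed.

Lemma comod_alpha_bij : bijective comod_alpha.
Proof.
exists (fun w => sval (cid (comod_alpha_surj w))) => w; last first.
  exact: (esym (svalP (cid (comod_alpha_surj w)))).
apply/eqP; rewrite -subr_eq0; apply/eqP/comod_alpha_inj0; rewrite linearB /=.
by rewrite -(svalP (cid (comod_alpha_surj (comod_alpha w)))) subrr.
Qed.

(** Applying s to x^n = λ(z^n - 1) compares α^n(v) with v, because s(z^n ⊗ v) = v ⊗ z^n. *)
Lemma comod_alpha_iter : lam_zn z lam n != 0 -> forall v, iter n comod_alpha v = v.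
Proof.
move=> lz v.
have lam0 : lam != 0 by apply: contraNneq lz => l0; rewrite /lam_zn l0 scale0r.
have zn : (1 == z ^+ n)%g = false.
  by apply: contraNF lz => /eqP zn; rewrite /lam_zn -zn subrr scaler0.
have Ez i w : eigen (z ^+ i) (z ^+ i) w.
  elim: i w => [|i IH] w; first exact: eigen1.
  by rewrite expgS; apply: eigenM => //; apply: eigen_z.
pose y : H := iota (z ^+ n) + (-1) *: iota 1.
have sy : s (y ⊗ₜ v) = v ⊗ₜ y.
  by rewrite tensDl tensZl linearD linearZ /= Ez eigen1 tensDr tensZr.
have := s_xn n v; have -> : x ^+ n = lam *: y by rewrite (hd_xn hH) /y scaleN1r (hd_1 hH).
rewrite tensZl tensZr !linearZ /= sy => /(scalerI lam0).
(* As z^n <> 1, only the term -1 of y contributes to the coordinate at the unit, which is therefore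
   nonzero and detects v. *)
have cy : cx 1 0 y = -1.
  by rewrite linearD linearZ /= -!exE !cx_ex ?n_gt0 // zn !eqxx add0r scale_regE mulr1.
move/(congr1 (teval_r (cx 1 0))); rewrite !teval_rE /= cy !scaleN1r => /oppr_inj.
by move/esym.
Qed.

(** * Decomposition of [V] by automorphisms *)

Definition eigen_space (zeta : aut_type chi z) (w : V) : Prop :=
  forall a, eigen a (val zeta a) w.

Lemma eigen0 a b : eigen a b 0.
Proof. by rewrite /eigen tens0r tens0l linear0. Qed.

Lemma eigenD a b u v : eigen a b u -> eigen a b v -> eigen a b (u + v).
Proof. by rewrite /eigen tensDr tensDl linearD => -> ->. Qed.

Lemma eigenZ a b c v : eigen a b v -> eigen a b (c *: v).
Proof. by rewrite /eigen tensZr tensZl linearZ /= => ->. Qed.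

Lemma eigen_uniq a b c w : eigen a b w -> eigen a c w -> w != 0 -> b = c.
Proof.
move=> Eb Ec; apply: contraNeq => bc; have := eigen_scoef b Eb.
by rewrite (eigen_scoef b Ec) (negPf bc) eqxx scale0r scale1r => ->.
Qed.

(** A nonzero vector has a single eigenvalue for each a, which makes ζ multiplicative and makes it
    fix z; χ is preserved by [eigen_chi]. *)
Lemma eigen_aut w (zeta : gT -> gT) : w != 0 -> (forall a, eigen a (zeta a) w) ->
  exists zeta' : aut_type chi z, eigen_space zeta' w.
Proof.
move=> w0 Ew.
have zM a b : zeta (a * b)%g = (zeta a * zeta b)%g.
  exact: eigen_uniq (Ew _) (eigenM (Ew a) (Ew b)) w0.
have z_inj : injective zeta.
  move=> a b ab; apply/eqP; apply: contra_neqT w0 => /negPf nab.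
  (* If ζ(a) = ζ(b), then s kills (a - b) ⊗ w, so a = b by injectivity of s. *)
  have : (iota a + (-1) *: iota b) ⊗ₜ w = 0.
    apply: (bij_inj (ls_bij sV)); rewrite linear0 tensDl tensZl linearD linearZ /=.
    by rewrite !Ew ab scaleN1r subrr.
  move/(congr1 (teval_l (cx a 0))); rewrite teval_lE linear0 linearD linearZ /=.
  by rewrite -!exE !cx_ex ?n_gt0 // !eqxx nab /= scale_regE mulr0 addr0 scale1r.
have phiE := permE z_inj; set phi := perm z_inj in phiE.
suff phiA : phi \in aut_chi_z chi z.
  by exists (exist _ phi phiA) => a /=; rewrite phiE; apply: Ew.
rewrite inE; apply/and3P; split.
- rewrite inE; apply/andP; split; first by apply/subsetP => a _; rewrite inE.
  by apply/morphicP => a b _ _; rewrite !phiE zM.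
- by rewrite phiE; apply/eqP; apply: eigen_uniq (Ew z) (eigen_z w) w0.
- by apply/forallP => a; rewrite phiE; apply/eqP; apply: eigen_chi (Ew a) w0.
Qed.

(** Induction on a list [l] outside which w is already an eigenvector of every group element.
    Splitting w along one more a preserves the earlier eigenvectors, since all the projections
    commute; for empty [l], [eigen_aut] applies unless w = 0. *)
Lemma eigen_decomp v : exists2 f : aut_type chi z -> V,
  forall zeta, eigen_space zeta (f zeta) & v = \sum_zeta f zeta.
Proof.
suff dec (l : seq gT) : forall w,
    (forall a, a \notin l -> exists b, eigen a b w) ->
    exists2 f : aut_type chi z -> V,
      forall zeta, eigen_space zeta (f zeta) & w = \sum_zeta f zeta.
  by apply: (dec (enum gT)) => a; rewrite mem_enum.
elim: l => [|a l IH] w Ew.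
  have [->|w0] := eqVneq w 0.
    by exists (fun=> 0) => [zeta a|]; [exact: eigen0 | rewrite big1].
  have E a : exists b, eigen a b w by apply: Ew.
  have [zeta zetaE] := eigen_aut w0 (fun a => svalP (cid (E a))).
  exists (fun xi => if xi == zeta then w else 0).
    by move=> xi; case: eqP => [-> //|_] a; exact: eigen0.
  by rewrite -big_mkcond big_pred1_eq.
have decP b : exists2 f : aut_type chi z -> V,
    forall zeta, eigen_space zeta (f zeta) & scoef (iota a) b 0 w = \sum_zeta f zeta.
  apply: IH => c cl; have [->|ca] := eqVneq c a; first by exists b; exact: eigen_proj.
  have [|d Ed] := Ew c; first by rewrite inE negb_or ca.
  by exists d; rewrite -(exE a); apply: eigen_comm n_gt0 Ed.
exists (fun zeta => \sum_b s2val (cid2 (decP b)) zeta).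
  move=> zeta c; apply: (big_ind (eigen c (val zeta c))); first exact: eigen0.
    exact: eigenD.
  by move=> b _; apply: (s2valP (cid2 (decP b))).
rewrite exchange_big {1}[w](scoef_iota_sum a); apply: eq_bigr => b _.
exact: (s2valP' (cid2 (decP b))).
Qed.

(** The product over a of the projections onto eigenvalue ζ(a). It extracts the ζ-component
    explicitly, whence the uniqueness of decompositions. *)
Definition eigen_part (zeta : aut_type chi z) : V -> V :=
  foldr (fun a (f : V -> V) => f \o scoef (iota a) (val zeta a) 0) idfun (enum gT).

Lemma eigen_part_eigen zeta xi w : eigen_space xi w ->
  eigen_part zeta w = (zeta == xi)%:R *: w.
Proof.
move=> Ew.
have -> : eigen_part zeta w = (all (fun a => val zeta a == val xi a) (enum gT))%:R *: w.
  rewrite /eigen_part; elim: (enum gT) => [|a l IH] /=; first by rewrite scale1r.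
  rewrite (eigen_scoef _ (Ew a)).
  case: eqP => _; first by rewrite scale1r IH.
  have F0 l' :
      foldr (fun a (f : V -> V) => f \o scoef (iota a) (val zeta a) 0) idfun l' 0 = 0.
    by elim: l' => //= b l' IH'; rewrite linear0.
  by rewrite !scale0r F0.
congr ((nat_of_bool _)%:R *: _); apply/allP/eqP => [zx|-> //].
by apply/val_inj/permP => a; apply/eqP/zx; rewrite mem_enum.
Qed.

Lemma eigen_partD zeta u v : eigen_part zeta (u + v) = eigen_part zeta u + eigen_part zeta v.
Proof.
rewrite /eigen_part; elim: (enum gT) u v => //= a l IH u v.
by rewrite linearD /= IH.
Qed.

(** * The coaction: its gradation and its nilpotent operator *)

Hypothesis snu : is_right_comodule s nu.

Lemma ncoef_coassoc g i g' i' v : ncoef g i (ncoef g' i' v) =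
  ((g' == g * z ^+ i)%g%:R * qbin t (i + i') i) *: ncoef g (i + i') v.
Proof. by rewrite -teval_Delta -(rc_coassoc snu) teval_r_tassoc. Qed.

Lemma ncoef_scoef g i h g' i' v :
  ncoef g i (scoef h g' i' v) = q ^+ (i * i') *: scoef h g' i' (ncoef g i v).
Proof.
have := rc_braid snu (h ⊗ₜ v).
move/(congr1 (teval_r (tform (cx g i) (cx g' i')))).
by rewrite teval_r_tassoc teval_braid tmapE teval_r_pass.
Qed.

Lemma ncoef_sum v : v = \sum_g ncoef g 0 v.
Proof. by rewrite -teval_r_eps (rc_counit snu). Qed.

Lemma ncoef_idem g g' i v : ncoef g 0 (ncoef g' i v) = (g' == g)%:R *: ncoef g i v.
Proof. by rewrite ncoef_coassoc expg0 mulg1 add0n qbin0 mulr1. Qed.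

Lemma ncoef_ncoef0 g i g' v : ncoef g i (ncoef g' 0 v) = (g' == g * z ^+ i)%g%:R *: ncoef g i v.
Proof. by rewrite ncoef_coassoc addn0 qbinn mulr1. Qed.

Lemma ncoef_eigen a b g i w : eigen a b w -> eigen a b (ncoef g i w).
Proof.
move=> Ew; apply: scoef_eigen; have := ncoef_scoef g i (iota a) b 0 w.
by rewrite muln0 expr0 scale1r (eigen_scoef _ Ew) eqxx scale1r => /esym.
Qed.

Lemma ncoef_alpha g i v : ncoef g i (comod_alpha v) = q ^+ i *: comod_alpha (ncoef g i v).
Proof. by have := ncoef_scoef g i x 1 1 v; rewrite muln1. Qed.

Definition comod_U v := \sum_g ncoef g 1 v.
Fact comod_U_is_linear : linear comod_U.
Proof.
move=> c u v; rewrite /comod_U scaler_sumr -big_split; apply: eq_bigr => g _.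
by rewrite linearP.
Qed.
HB.instance Definition _ := GRing.isLinear.Build k V V *:%R comod_U comod_U_is_linear.

Lemma qbin1 i : qbin t i 1 = qnat t i.
Proof.
elim: i => [|i IH]; first by rewrite /qnat big_ord0.
by rewrite /= IH qbin0 subn0 mulr1 /qnat big_ord_recr.
Qed.

Lemma comod_U_ncoef g i v : comod_U (ncoef g i v) = qnat t i.+1 *: ncoef (g * z^-1)%g i.+1 v.
Proof.
rewrite /comod_U (bigD1 (g * z^-1)%g) //= big1 ?addr0.
  by rewrite ncoef_coassoc expg1 mulgKV eqxx mul1r add1n qbin1.
move=> h hg; rewrite ncoef_coassoc expg1.
suff -> : (g == h * z)%g = false by rewrite mul0r scale0r.
by apply: contraNF hg => /eqP->; rewrite mulgK.
Qed.

(** Each application of U to a coefficient raises its exponent by one and contributes a factor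
    (j+1)_t, whence the q-factorial. There is no bound on j: at j = n the right side is 0, which
    gives U^n = 0. *)
Lemma iter_comod_U g j v : ncoef g 0 v = v ->
  iter j comod_U v = qfact t j *: ncoef (z ^- j * g)%g j v.
Proof.
move=> Nv; elim: j => [|j IH]; first by rewrite qfact0 scale1r expg0 invg1 mul1g Nv.
rewrite iterS IH linearZ /= comod_U_ncoef scalerA -qfactS; congr (_ *: ncoef _ _ _).
rewrite expgSr invMg -[RHS]mulgA.
exact: (commuteV (commute_sym (zC _))).
Qed.

Definition comod_W (i : gT * aut_type chi z) : {pred V} :=
  fun v => `[< ncoef i.1 0 v = v /\ eigen_space i.2 v >].

Lemma comod_W_mem i v : v \in comod_W i <-> ncoef i.1 0 v = v /\ eigen_space i.2 v.
Proof. by split=> [/asboolP|Wv]; last exact/asboolP. Qed.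

Lemma comod_W_gradation : is_gradation comod_W.
Proof.
split=> [i|v].
  split=> [|c u v /comod_W_mem[Nu Eu] /comod_W_mem[Nv Ev]]; apply/comod_W_mem; split.
  - by rewrite linear0.
  - by move=> a; exact: eigen0.
  - by rewrite linearP /= Nu Nv.
  - by move=> a; apply: eigenD => //; exact: eigenZ.
(* Any homogeneous decomposition is recovered from v by projecting first with the coaction and then
   with [eigen_part]; this gives uniqueness. *)
have comod_W_part f : (forall i, f i \in comod_W i) -> v = \sum_i f i ->
    forall i, f i = eigen_part i.2 (ncoef i.1 0 v).
  move=> Wf -> [g zeta]; rewrite linear_sum.
  have part0 : eigen_part zeta 0 = 0.
    by rewrite (@eigen_part_eigen _ zeta) ?scaler0 // => a; exact: eigen0.
  rewrite (big_morph _ (eigen_partD zeta) part0) (bigD1 (g, zeta)) //= big1 ?addr0.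
    have [/= -> Ef] := (comod_W_mem _ _).1 (Wf (g, zeta)).
    by rewrite (eigen_part_eigen _ Ef) eqxx scale1r.
  move=> [h xi] hxi; have [/= Nf Ef] := (comod_W_mem _ _).1 (Wf (h, xi)).
  rewrite -Nf ncoef_idem; have [hg|_] := eqVneq h g; last by rewrite scale0r.
  rewrite scale1r -hg Nf (eigen_part_eigen _ Ef).
  have [xz|_] := eqVneq zeta xi; last by rewrite scale0r.
  by rewrite hg xz eqxx in hxi.
have [f0 Ef0 vf0] := eigen_decomp v.
pose f := [ffun i : gT * aut_type chi z => ncoef i.1 0 (f0 i.2)].
have Wf i : f i \in comod_W i.
  apply/comod_W_mem; rewrite ffunE ncoef_idem eqxx scale1r; split=> // a.
  exact: ncoef_eigen (Ef0 _ a).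
have vf : v = \sum_i f i.
  rewrite [LHS]ncoef_sum {1}vf0 (eq_bigr (fun g => \sum_zeta ncoef g 0 (f0 zeta))).
    by rewrite pair_big; apply: eq_bigr => i _; rewrite ffunE.
  by move=> g _; rewrite linear_sum.
exists f; split=> [//|f' [Wf' vf']]; apply/ffunP => i.
by rewrite (comod_W_part f Wf vf) (comod_W_part f' Wf' vf').
Qed.

Lemma comodule_datum : is_comodule_datum lam q n comod_W comod_alpha comod_U.
Proof.
split.
- exact: comod_W_gradation.
- exact: comod_alpha_bij.
- exact: comod_alpha_iter.
- move=> [g zeta] v; split=> [/comod_W_mem[/= Nv Ev]|[w /comod_W_mem[/= Nw Ew] ->]]; last first.
    apply/comod_W_mem; rewrite /= ncoef_alpha expr0 scale1r Nw.
    by split=> // a; apply: eigen_alpha.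
  (* A preimage under α is again homogeneous, since the injective α commutes with both kinds of
     projections. *)
  have [w vw] := comod_alpha_surj v; exists w => //; apply/comod_W_mem; split=> /=.
    by apply: (bij_inj comod_alpha_bij); rewrite -vw -[RHS]Nv vw ncoef_alpha expr0 scale1r.
  move=> a; apply: scoef_eigen; apply: (bij_inj comod_alpha_bij).
  have := eigen_scoef (val zeta a) (Ev a); rewrite eqxx scale1r vw /comod_alpha -exx.
  by rewrite scoef_iota_comm ?n_gt1.
- move=> v; rewrite /= /comod_U (linear_sum comod_alpha) scaler_sumr; apply: eq_bigr => g _.
  by rewrite ncoef_alpha expr1.
- move=> v; have -> : iter n comod_U v = \sum_g iter n comod_U (ncoef g 0 v).
    rewrite {1}[v]ncoef_sum; elim: n => //= m ->; exact: linear_sum.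
  rewrite big1 // => g _; rewrite (@iter_comod_U g); last by rewrite ncoef_idem eqxx scale1r.
  suff ncoef_n h w : ncoef h n w = 0 by rewrite ncoef_n scaler0.
  by rewrite /ncoef cx_tens_ge.
- move=> g zeta v /comod_W_mem[/= Nv Ev]; apply/comod_W_mem.
  rewrite -Nv comod_U_ncoef /=; split.
    by rewrite linearZ /= ncoef_idem eqxx scale1r.
  by move=> a; apply/eigenZ/ncoef_eigen.
Qed.

Lemma transposition_of : is_transposition_of n comod_W iota x comod_alpha s.
Proof.
move=> g i zeta v [f Wf ->]; apply: s_ex_eigen.
apply: (big_ind (eigen g (val zeta g))); first exact: eigen0.
  exact: eigenD.
by move=> h _; have /comod_W_mem[_] := Wf h; apply.
Qed.

Lemma coaction_of : is_coaction_of q n comod_W iota x comod_U nu.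
Proof.
move=> g v [f Wf vf].
have Nv : ncoef g 0 v = v.
  rewrite vf linear_sum; apply: eq_bigr => zeta _.
  by have /comod_W_mem[] := Wf zeta.
rewrite [LHS]cx_tens_sum exchange_big; apply: eq_bigr => j _ /=.
rewrite (iter_comod_U _ Nv) tensZl scalerA mulVf ?qfact_neq0 // scale1r.
rewrite (bigD1 (z ^- j * g)%g) //= big1 ?addr0 // => h hg.
(* A vector of degree g has a coefficient at h x^j only if g = h z^j, that is, h = z^-j g. *)
rewrite -[teval_r _ _]/(ncoef h j v) -Nv ncoef_ncoef0.
suff -> : (g == h * z ^+ j)%g = false by rewrite scale0r tens0l.
apply: contraNF hg => /eqP->.
by rewrite (commuteX j (commute_sym (zC h))) mulKg.
Qed.

End Classification.
End KropHopf.

Theorem corollary3p7 (k : fieldType) (gT : finGroupType)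
    (chi : gT -> k) (z : gT) (lam q : k) (n : nat)
    (hD : is_HD_datum chi z lam q n)
    (H : braidedHopf k) (iota : gT -> H) (x : H)
    (hH : is_HD chi z lam q n iota x)
    (hpq : (chi z, q) <> (1, -1))
    (V : lmodType k) :
  (forall (W : gT * aut_type chi z -> {pred V}) (alpha U : {linear V -> V}),
     is_comodule_datum lam q n W alpha U ->
     exists (s : {linear H ⊗ V -> V ⊗ H}) (nu : {linear V -> V ⊗ H}),
       [/\ is_right_comodule s nu,
           is_transposition_of n W iota x alpha s,
           is_coaction_of q n W iota x U nu
         & forall (s' : {linear H ⊗ V -> V ⊗ H}) (nu' : {linear V -> V ⊗ H}),
             is_transposition_of n W iota x alpha s' ->
             is_coaction_of q n W iota x U nu' ->
             s' =1 s /\ nu' =1 nu])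
  /\
  (forall (s : {linear H ⊗ V -> V ⊗ H}) (nu : {linear V -> V ⊗ H}),
     is_right_comodule s nu ->
     exists (W : gT * aut_type chi z -> {pred V}) (alpha U : {linear V -> V}),
       [/\ is_comodule_datum lam q n W alpha U,
           is_transposition_of n W iota x alpha s
         & is_coaction_of q n W iota x U nu]).
Proof.
split=> [W alpha U dat|s nu snu]; first exact: (comodule_of_datum hD hH dat).
have sV := rc_left_space snu.
exists (@comod_W _ _ chi z lam q n H iota x hH V s nu),
  (comod_alpha hH s), (comod_U hH nu); split.
- exact: comodule_datum.
- exact: transposition_of.
- exact: coaction_of.
Qed.
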